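(* There is a polynomial-time algorithm which, given as input a simple $(3,4)$-biregular bigraph $G$, constructs a path factor of $G$ such that the endpoints of each of its component paths have degree $3$ in $G$.
   Context: Graphs are finite and loop-free; a simple graph has no multiple edges. A $(3,4)$-biregular bigraph is a bipartite graph $G$ with bipartition $(Y,X)$ (every edge joins a vertex of $Y$ to a vertex of $X$) in which every vertex of $Y$ has degree $3$ and every vertex of $X$ has degree $4$. $G$ is not assumed connected. A path factor of a graph $G$ is a spanning subgraph of $G$ (containing all vertices of $G$) each of whose connected components is a nontrivial path, i.e. a path with at least one edge. Polynomial time means that the running time is bounded by a polynomial in the size (number of vertices and edges) of $G$. *)

(* Defs.v *)
From HB Require Import structures.
From mathcomp Require Import all_boot all_order all_algebra.
Set Implicit Arguments.
Unset Strict Implicit.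
Unset Printing Implicit Defensive.

(* A simple graph on the vertex set {0, ..., n-1} is a symmetric irreflexive
   [e : rel 'I_n]. *)
Definition simple_graph (n : nat) (e : rel 'I_n) : Prop :=
  symmetric e /\ irreflexive e.

Definition degree (n : nat) (e : rel 'I_n) (v : 'I_n) : nat :=
  #|[set w | e v w]|.

Definition num_edges (n : nat) (e : rel 'I_n) : nat :=
  #|[set p : 'I_n * 'I_n | (p.1 < p.2) && e p.1 p.2]|.

Definition bipartition (n : nat) (e : rel 'I_n) (Y X : {set 'I_n}) : Prop :=
  [/\ Y :|: X = [set: 'I_n], [disjoint Y & X] &
      forall u v, e u v ->
        (u \in Y) && (v \in X) || (u \in X) && (v \in Y)].

Definition biregular_bigraph34 (n : nat) (e : rel 'I_n) : Prop :=
  exists Y X : {set 'I_n},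
    [/\ bipartition e Y X,
        forall y, y \in Y -> degree e y = 3 &
        forall x, x \in X -> degree e x = 4].

(* The vertex sequence x :: q lists, in order along the path and without
   repetition, a whole connected component of f, and this component is a path
   with at least one edge: the edges of f inside it are exactly the pairs of
   consecutive entries.  Its endpoints are x and [last x q]. *)
Definition path_component (n : nat) (f : rel 'I_n) (x : 'I_n) (q : seq 'I_n)
    : Prop :=
  [/\ 0 < size q, uniq (x :: q), x :: q =i connect f x &
      {in x :: q &, forall u w,
         f u w = ((u, w) \in zip (x :: q) q) || ((w, u) \in zip (x :: q) q)}].

(* The subgraph f is spanning because it has the same vertex type as e. *)
Definition path_factor (n : nat) (e f : rel 'I_n) : Prop :=
  [/\ symmetric f, subrel f e &
      forall v, exists x q, path_component f x q /\ v \in x :: q].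

Definition endpoints_of_degree (d n : nat) (e f : rel 'I_n) : Prop :=
  forall x q, path_component f x q -> degree e x = d /\ degree e (last x q) = d.

(* The WHILE language over binary trees (N. D. Jones, "Computability and
   Complexity from a Programming Perspective").  In place of the usual unit
   cost, which presupposes that subtrees are shared, every value produced during
   the evaluation of an expression is charged its full number of nodes.  So
   values never outgrow the time already spent (plus the input size), and the
   model is polynomially equivalent to Turing machines. *)

Inductive tree : Type := Leaf | Node of tree & tree.

Fixpoint tsize (a : tree) : nat :=
  if a is Node b c then (tsize b + tsize c).+1 else 1.

Definition hd (a : tree) : tree := if a is Node b _ then b else Leaf.
Definition tl (a : tree) : tree := if a is Node _ c then c else Leaf.
Definition truth (a : tree) : bool := if a is Leaf then false else true.

Inductive expr : Type :=
  | Var of nat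
  | ELeaf
  | ENode of expr & expr
  | EHd of expr
  | ETl of expr.

Inductive cmd : Type :=
  | Skip
  | Assign of nat & expr
  | Seq of cmd & cmd
  | If of expr & cmd & cmd
  | While of expr & cmd.

Definition store := nat -> tree.

Definition update (s : store) (x : nat) (a : tree) : store :=
  fun y => if y == x then a else s y.

Fixpoint eval (s : store) (E : expr) : tree :=
  match E with
  | Var x => s x
  | ELeaf => Leaf
  | ENode E1 E2 => Node (eval s E1) (eval s E2)
  | EHd E1 => hd (eval s E1)
  | ETl E1 => tl (eval s E1)
  end.

Fixpoint ecost (s : store) (E : expr) : nat :=
  tsize (eval s E) +
  match E with
  | Var _ | ELeaf => 0
  | ENode E1 E2 => ecost s E1 + ecost s E2
  | EHd E1 | ETl E1 => ecost s E1
  end.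

(* [exec c s t s']: started in store s, the command c halts after time t in
   store s'. *)
Inductive exec : cmd -> store -> nat -> store -> Prop :=
  | exec_skip s : exec Skip s 1 s
  | exec_assign x E s :
      exec (Assign x E) s (ecost s E).+1 (update s x (eval s E))
  | exec_seq c1 c2 s1 s2 s3 t1 t2 :
      exec c1 s1 t1 s2 -> exec c2 s2 t2 s3 ->
      exec (Seq c1 c2) s1 (t1 + t2).+1 s3
  | exec_if E c1 c2 s s' t :
      exec (if truth (eval s E) then c1 else c2) s t s' ->
      exec (If E c1 c2) s (ecost s E + t).+1 s'
  | exec_while_false E c s :
      ~~ truth (eval s E) ->
      exec (While E c) s (ecost s E).+1 s
  | exec_while_true E c s1 s2 s3 t1 t2 :
      truth (eval s1 E) ->
      exec c s1 t1 s2 -> exec (While E c) s2 t2 s3 ->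
      exec (While E c) s1 (ecost s1 E + t1 + t2).+1 s3.

(* Input and output are both held by variable 0; all other variables are
   initially Leaf. *)
Definition computes_in_time (c : cmd) (a b : tree) (t : nat) : Prop :=
  exists s, exec c (update (fun=> Leaf) 0 a) t s /\ s 0 = b.

(* A graph is presented by its adjacency lists.  Vertex names are written in
   unary, which is harmless for polynomial time: a name is smaller than the
   number of vertices. *)

Fixpoint encode_nat (k : nat) : tree :=
  if k is k'.+1 then Node Leaf (encode_nat k') else Leaf.

Definition encode_seq (s : seq tree) : tree := foldr Node Leaf s.

Definition encode_graph (n : nat) (e : rel 'I_n) : tree :=
  encode_seq [seq encode_seq [seq encode_nat (val j) | j <- enum 'I_n & e i j]
             | i <- enum 'I_n].

(* Main.v *)
(* A path factor with endpoints of degree 3 is a subgraph without cycle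
   components in which every vertex of X (degree 4) has degree 2 and every vertex
   of Y (degree 3) has degree 1 or 2.  It is reached in three stages, B, C and D.

   Stage B works with the subgraphs that omit exactly one edge at each y in Y.
   The potential counts the missing degrees below 2 and the cycle components.
   A vertex is active if its degree is at most 1 or if it lies on a cycle
   component.  A move adds an omitted edge xy at an active x and removes a kept
   edge ay instead.  By a parity argument, for each such xy one of the two
   choices of a lowers the potential, or keeps it and makes a active.  The search
   explores the states of equal potential that activate new vertices.  If it is
   stuck, let R be the set of the vertices of X that were ever active: an omitted
   edge xy with x in R comes with a kept edge ay with a in R, and counting the
   edges at R gives potential 0.

   Stage C removes edges at the vertices of X of degree at least 3; again by
   parity, one of any two edges at such a vertex can go without leaving a cycle
   component.

   Stage D treats the isolated y in Y: a move adds an edge xy and removes another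
   edge at x.  If the search is stuck, let Z be the set of the vertices that were
   ever isolated and N the set of their neighbours.  The edges of G at Z end in N,
   so 3|Z| <= 4|N|; the edges of the subgraph at N end in Z, where they leave
   degrees at most 1 and some degree 0, so 2|N| < |Z|: a contradiction. *)

(* The count in stage B compares the kept and the omitted edges at R in the oldest state of the
   current potential. Every y has just one omitted edge, so the pairing yields at least as many kept
   as omitted edges at R. A vertex of degree k has k kept and 4 - k omitted edges; so if all degrees
   in R are at most 2, none is below 2. The obstacle is a vertex of degree 3 in R, with a surplus of
   2. It became active only because a move left it on a cycle. All vertices of that cycle are
   active, so its two neighbours there newly have both kept edges at R, and these two extra kept
   edges use up the surplus. A cycle in the oldest state would provide such y with no surplus to
   match, so there is none. A vertex of degree 4 never enters R, since losing one edge leaves degree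
   3. The tree programs are not analysed command by command: polynomial time follows from closure
   properties, with a right fold as the only loop, and correctness from equations relating them to
   searches on edge sets. *)
Require Import Defs.
From HB Require Import structures.
From mathcomp Require Import all_boot all_order all_algebra.
From mathcomp Require Import zify.
Set Implicit Arguments.
Unset Strict Implicit.
Unset Printing Implicit Defensive.
Local Notation tsize := Defs.tsize.

(** * Polynomial time on trees *)

Definition poly_bounded (F : nat -> nat) :=
  exists d, forall m, F m <= m.+2 ^ d.

Lemma pb_le F G : poly_bounded G -> (forall m, F m <= G m) -> poly_bounded F.
Proof. by move=> [d H] FG; exists d => m; apply: leq_trans (FG m) (H m). Qed.

(** The base [m.+2] is at least 2, so the constant itself can serve as the exponent; this is why the
    bound is not a power of [m]. *)
Lemma pb_const c : poly_bounded (fun=> c).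
Proof.
exists c => m; apply: (@leq_trans (2 ^ c)); first exact/ltnW/ltn_expl.
by case: c => // c; rewrite leq_exp2r.
Qed.

Lemma pb_id : poly_bounded id.
Proof. by exists 1 => m; rewrite expn1; lia. Qed.

Lemma pb_add F G :
  poly_bounded F -> poly_bounded G -> poly_bounded (fun m => F m + G m).
Proof.
move=> [d1 H1] [d2 H2]; exists (d1 + d2).+1 => m; rewrite expnS.
have le1 : m.+2 ^ d1 <= m.+2 ^ (d1 + d2) by rewrite leq_exp2l //; lia.
have le2 : m.+2 ^ d2 <= m.+2 ^ (d1 + d2) by rewrite leq_exp2l //; lia.
have := H1 m; have := H2 m; nia.
Qed.

Lemma pb_mul F G :
  poly_bounded F -> poly_bounded G -> poly_bounded (fun m => F m * G m).
Proof.
by move=> [d1 H1] [d2 H2]; exists (d1 + d2) => m; rewrite expnD leq_mul.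
Qed.

Lemma pb_succ F : poly_bounded F -> poly_bounded (fun m => (F m).+1).
Proof.
by move=> HF; apply: pb_le (pb_add HF (pb_const 1)) _ => m; rewrite addn1.
Qed.

Lemma pb_exp F d : poly_bounded F -> poly_bounded (fun m => F m ^ d).
Proof. by move=> [d1 H1]; exists (d1 * d) => m; rewrite expnM; case: d => // d; rewrite leq_exp2r. Qed.

Ltac pbound := cbv beta; repeat
  match goal with
  | |- poly_bounded id => exact: pb_id
  | |- poly_bounded (fun m => m) => exact: pb_id
  | |- poly_bounded (fun m => ?c) => exact: (pb_const c)
  | |- poly_bounded (fun m => @?F m + @?G m) => refine (@pb_add F G _ _)
  | |- poly_bounded (fun m => @?F m * @?G m) => refine (@pb_mul F G _ _)
  | |- poly_bounded (fun m => @?F m ^ ?d) => refine (@pb_exp F d _)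
  | |- poly_bounded (fun m => (@?F m).+1) => refine (@pb_succ F _)
  end.

Lemma tsize_gt0 a : 0 < tsize a. Proof. by case: a. Qed.
Lemma tsize_hd a : tsize (hd a) <= tsize a. Proof. by case: a => //= b c; lia. Qed.
Lemma tsize_tl a : tsize (tl a) <= tsize a. Proof. by case: a => //= b c; lia. Qed.

Definition runs (c : cmd) (s : store) (Q : store -> Prop) (T : nat) :=
  exists s' t, [/\ exec c s t s', Q s' & t <= T].

Lemma runs_skip s (Q : store -> Prop) T : Q s -> 0 < T -> runs Skip s Q T.
Proof. by exists s, 1; split=> //; constructor. Qed.

Lemma runs_assign x E s (Q : store -> Prop) T :
  Q (update s x (eval s E)) -> ecost s E < T -> runs (Assign x E) s Q T.
Proof. by move=> HQ HT; do 2 eexists; split; [constructor| exact: HQ | ]. Qed.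

Lemma runs_seq c1 c2 s Q1 (Q : store -> Prop) T1 T2 T :
  runs c1 s Q1 T1 -> (forall s', Q1 s' -> runs c2 s' Q T2) ->
  T1 + T2 < T -> runs (Seq c1 c2) s Q T.
Proof.
move=> [s1 [t1 [e1 q1 l1]]] H2 lT; have [s2 [t2 [e2 q2 l2]]] := H2 _ q1.
by exists s2, (t1 + t2).+1; split=> //; [apply: exec_seq e1 e2 | lia].
Qed.

Lemma runs_weak c s (Q Q' : store -> Prop) T T' :
  runs c s Q T -> (forall s', Q s' -> Q' s') -> T <= T' -> runs c s Q' T'.
Proof.
by move=> [s1 [t1 [e1 q1 l1]]] HQ lT; exists s1, t1; split=> //; [exact: HQ|lia].
Qed.

(* Variable 0 holds the argument and the result; c may clobber the variables
   below k, whatever they contain initially. *)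
Definition polytime (f : tree -> tree) :=
  exists (c : cmd) (k d : nat), [/\ 0 < k,
    forall s, runs c s (fun s' => s' 0 = f (s 0) /\ forall y, k <= y -> s' y = s y)
      ((tsize (s 0)).+2 ^ d) &
    forall a, tsize (f a) <= (tsize a).+2 ^ d].

Lemma polytimeI (f : tree -> tree) c k F G : 0 < k ->
  (forall s, runs c s (fun s' => s' 0 = f (s 0) /\ forall y, k <= y -> s' y = s y)
     (F (tsize (s 0)))) ->
  poly_bounded F ->
  (forall a, tsize (f a) <= G (tsize a)) -> poly_bounded G -> polytime f.
Proof.
move=> k_gt0 Hr [d1 H1] Hs [d2 H2]; exists c, k, (d1 + d2); split=> // [s|a].
  apply: runs_weak (Hr s) _ _ => //; apply: leq_trans (H1 _) _.
  by rewrite leq_exp2l //; lia.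
by apply: leq_trans (Hs _) _; apply: leq_trans (H2 _) _; rewrite leq_exp2l //; lia.
Qed.

Lemma polytime_id : polytime id.
Proof.
apply: (@polytimeI _ Skip 1 (fun=> 1) id) => //; last by pbound.
- by move=> s; apply: runs_skip.
- by pbound.
Qed.

Lemma polytime_leaf : polytime (fun=> Leaf).
Proof.
apply: (@polytimeI _ (Assign 0 ELeaf) 1 (fun=> 2) (fun=> 1)) => //; try by pbound.
by move=> s; apply: runs_assign => //; split=> // y; rewrite /update; case: y.
Qed.

(** The outer command is timed on the output of the inner one, which is why [polytime] also bounds
    the size of the value. *)
Lemma polytime_comp f g : polytime f -> polytime g -> polytime (fun a => f (g a)).
Proof.
move=> [cf [kf [df [kf0 Rf Sf]]]] [cg [kg [dg [kg0 Rg Sg]]]].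
apply: (@polytimeI _ (Seq cg cf) (kf + kg)
  (fun m => (m.+2 ^ dg + (m.+2 ^ dg).+2 ^ df).+1) (fun m => (m.+2 ^ dg).+2 ^ df)).
- by lia.
- move=> s; apply: (runs_seq (Rg s)) (leqnn _) => s1 [e1 f1].
  apply: runs_weak (Rf s1) _ _ => [s2 [e2 f2]|].
    by rewrite e2 e1; split=> // y hy; rewrite f2 ?f1 //; lia.
  by rewrite e1; case: df {Rf Sf} => // df; rewrite leq_exp2r // !ltnS.
- by pbound.
- move=> a; apply: leq_trans (Sf _) _.
  by case: df {Rf Sf} => // df; rewrite leq_exp2r // !ltnS.
- by pbound.
Qed.

Lemma polytime_hd f : polytime f -> polytime (fun a => hd (f a)).
Proof.
move=> Hf; apply: polytime_comp Hf.
apply: (@polytimeI _ (Assign 0 (EHd (Var 0))) 1 (fun m => (m + m).+1) id) => //; try by pbound.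
- move=> s; apply: runs_assign => /=; last by have := tsize_hd (s 0); lia.
  by split=> // y; rewrite /update; case: y.
- exact: tsize_hd.
Qed.

Lemma polytime_tl f : polytime f -> polytime (fun a => tl (f a)).
Proof.
move=> Hf; apply: polytime_comp Hf.
apply: (@polytimeI _ (Assign 0 (ETl (Var 0))) 1 (fun m => (m + m).+1) id) => //; try by pbound.
- move=> s; apply: runs_assign => /=; last by have := tsize_tl (s 0); lia.
  by split=> // y; rewrite /update; case: y.
- exact: tsize_tl.
Qed.

Lemma update_eq s x a : update s x a x = a. Proof. by rewrite /update eqxx. Qed.
Lemma update_neq s x a y : y != x -> update s x a y = s y.
Proof. by rewrite /update => /negPf ->. Qed.

(* K keeps the argument, so that several functions can be applied to it in
   turn. *)
Lemma runs_save c f k d K x s : 0 < k -> k <= K -> K < x ->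
  (forall s, runs c s (fun s' => s' 0 = f (s 0) /\ forall y, k <= y -> s' y = s y)
      ((tsize (s 0)).+2 ^ d)) ->
  (forall a, tsize (f a) <= (tsize a).+2 ^ d) ->
  runs (Seq (Assign 0 (Var K)) (Seq c (Assign x (Var 0)))) s
   (fun s' => s' x = f (s K) /\ forall y, k <= y -> y != x -> s' y = s y)
   (2 * (tsize (s K)).+2 ^ d + tsize (s K) + 6).
Proof.
move=> k0 kK Kx R S.
apply: (@runs_seq _ _ _ (fun s1 => s1 0 = s K /\ forall y, 0 < y -> s1 y = s y) _
   (tsize (s K)).+2 (2 * (tsize (s K)).+2 ^ d + 3)).
- apply: runs_assign => /=; last by lia.
  by rewrite update_eq; split=> // y y0; rewrite update_neq //; lia.
- move=> s1 [e1 f1].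
  apply: (runs_seq (R s1)).
    move=> s2 [e2 f2]; apply: (@runs_assign _ _ _ _ (tsize (f (s K))).+1.+1) => /=.
      rewrite update_eq e2 e1; split=> // y ky yx.
      by rewrite update_neq // f2 // f1 //; lia.
    by rewrite e2 e1; lia.
  by rewrite e1; have := S (s K); lia.
- by lia.
Qed.

Lemma polytime_node f g : polytime f -> polytime g -> polytime (fun a => Node (f a) (g a)).
Proof.
move=> [cf [kf [df [kf0 Rf Sf]]]] [cg [kg [dg [kg0 Rg Sg]]]].
(* No variable from [K] on is touched by either command: [K] keeps the argument, the next two
   variables the two values. *)
set K := kf + kg.
set B := fun m => m.+2 ^ df + m.+2 ^ dg + m + 10.
apply: (@polytimeI _ (Seq (Assign K (Var 0))
  (Seq (Seq (Assign 0 (Var K)) (Seq cf (Assign K.+1 (Var 0))))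
  (Seq (Seq (Assign 0 (Var K)) (Seq cg (Assign K.+2 (Var 0))))
       (Assign 0 (ENode (Var K.+1) (Var K.+2)))))) K.+3
  (fun m => 20 * B m) B).
- by [].
- move=> s; set m := tsize (s 0).
  have [HB1 HB2 HB3 HB4] : [/\ m.+2 ^ df <= B m, m.+2 ^ dg <= B m, m <= B m & 10 <= B m].
    by rewrite /B; split; lia.
  apply: (@runs_seq _ _ _ (fun s1 => s1 K = s 0 /\ forall y, y != K -> s1 y = s y) _ m.+2 (14 * B m)).
  + apply: runs_assign => /=; last by rewrite -/m; lia.
    by rewrite update_eq; split=> // y yK; rewrite update_neq.
  + move=> s1 [e1 f1].
    apply: (runs_seq (@runs_save cf f kf df K K.+1 s1 kf0 _ _ Rf Sf) (T2 := 9 * B m));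
      [by rewrite /K; lia|by []| |by rewrite e1 -/m; lia].
    move=> s2 [e2 f2].
    have s2K : s2 K = s 0 by rewrite f2 ?e1 // /K; lia.
    apply: (runs_seq (@runs_save cg g kg dg K K.+2 s2 kg0 _ _ Rg Sg) (T2 := 5 * B m));
      [by rewrite /K; lia|by lia| |by rewrite s2K -/m; lia].
    move=> s3 [e3 f3].
    have s31 : s3 K.+1 = f (s 0) by rewrite f3 ?e2 ?e1 // /K; lia.
    apply: runs_assign => /=.
      rewrite update_eq e3 s31 s2K; split=> // y hy.
      by rewrite update_neq ?f3 ?f2 ?f1 //; rewrite /K in hy *; lia.
    by rewrite e3 s31 s2K; have := Sf (s 0); have := Sg (s 0); rewrite -/m; lia.
  + by lia.
- by rewrite /B; pbound.
- by move=> a /=; have := Sf a; have := Sg a; rewrite /B; lia.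
- by rewrite /B; pbound.
Qed.

Lemma polytime_if h f g : polytime h -> polytime f -> polytime g ->
  polytime (fun a => if truth (h a) then f a else g a).
Proof.
move=> [ch [kh [dh [kh0 Rh Sh]]]].
move=> [cf [kf [df [kf0 Rf Sf]]]] [cg [kg [dg [kg0 Rg Sg]]]].
set K := kh + kf + kg.
set B := fun m => m.+2 ^ dh + m.+2 ^ df + m.+2 ^ dg + m + 10.
apply: (@polytimeI _ (Seq (Assign K (Var 0))
  (Seq (Seq (Assign 0 (Var K)) (Seq ch (Assign K.+1 (Var 0))))
  (Seq (Assign 0 (Var K)) (If (Var K.+1) cf cg)))) K.+2
  (fun m => 20 * B m) B).
- by [].
- move=> s; set m := tsize (s 0).
  have [HB0 HB1 HB2 HB3 HB4] : [/\ m.+2 ^ dh <= B m, m.+2 ^ df <= B m, m.+2 ^ dg <= B m, m <= B m & 10 <= B m].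
    by rewrite /B; split; lia.
  apply: (@runs_seq _ _ _ (fun s1 => s1 K = s 0 /\ forall y, y != K -> s1 y = s y) _ m.+2 (14 * B m)).
  + apply: runs_assign => /=; last by rewrite -/m; lia.
    by rewrite update_eq; split=> // y yK; rewrite update_neq.
  + move=> s1 [e1 f1].
    apply: (runs_seq (@runs_save ch h kh dh K K.+1 s1 kh0 _ _ Rh Sh) (T2 := 9 * B m));
      [by rewrite /K; lia|by []| |by rewrite e1 -/m; lia].
    move=> s2 [e2 f2].
    have s2K : s2 K = s 0 by rewrite f2 ?e1 // /K; lia.
    apply: (@runs_seq _ _ _ (fun s3 => [/\ s3 0 = s 0, s3 K.+1 = h (s 0) &
       forall y, K.+2 <= y -> s3 y = s y]) _ m.+2 (7 * B m)).
    * apply: runs_assign => /=; last by rewrite s2K -/m; lia.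
      split; first by rewrite update_eq s2K.
        by rewrite update_neq // e2 e1.
      by move=> y hy; rewrite update_neq ?f2 ?f1 //; rewrite /K in hy *; lia.
    * move=> s3 [e30 e31 f3].
      have [s4 [t4 [E4 [r4 f4] l4]]] : runs (if truth (h (s 0)) then cf else cg) s3
          (fun s' => s' 0 = (if truth (h (s 0)) then f (s 0) else g (s 0)) /\
             forall y, K <= y -> s' y = s3 y) (B m).
        case: ifP => _.
          apply: runs_weak (Rf s3) _ _ => [s4 [-> F4]|]; last by rewrite e30.
          by rewrite e30; split=> // y hy; rewrite F4 //; rewrite /K in hy; lia.
        apply: runs_weak (Rg s3) _ _ => [s4 [-> F4]|]; last by rewrite e30.
        by rewrite e30; split=> // y hy; rewrite F4 //; rewrite /K in hy; lia.
      exists s4, (ecost s3 (Var K.+1) + t4).+1; split.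
      - by apply: exec_if => /=; rewrite e31.
      - by split=> // y hy; rewrite f4 ?f3 //; lia.
      - by rewrite /= e31; have := Sh (s 0); rewrite -/m; lia.
    * by lia.
  + by lia.
- by rewrite /B; pbound.
- by move=> a /=; have := Sf a; have := Sg a; rewrite /B; case: ifP; lia.
- by rewrite /B; pbound.
Qed.

(** The only iteration in the tree programs. Its number of rounds is fixed in advance, so only the
    size of the accumulator has to be controlled. *)
Fixpoint tfoldr (h : tree -> tree -> tree) (z l : tree) : tree :=
  if l is Node x l' then h x (tfoldr h z l') else z.

Fixpoint tlength (l : tree) : nat := if l is Node _ l' then (tlength l').+1 else 0.

Fixpoint trevcat (l r : tree) : tree :=
  if l is Node x l' then trevcat l' (Node x r) else r.

Lemma tlength_size l : tlength l <= tsize l.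
Proof. by elim: l => //= a _ b IH; lia. Qed.

Lemma tlength_revcat l r : tlength (trevcat l r) = tlength l + tlength r.
Proof. by elim: l r => //= a _ b IH r; rewrite IH /=; lia. Qed.

(** A right fold consumes the last entry first, whereas a loop meets the first one first; so the
    list is reversed before the fold. *)
Lemma runs_reverse i j s M : i != j -> tsize (s i) + tsize (s j) <= M ->
  runs (While (Var i) (Seq (Assign j (ENode (EHd (Var i)) (Var j)))
                           (Assign i (ETl (Var i))))) s
    (fun s' => s' j = trevcat (s i) (s j) /\ forall y, y != i -> y != j -> s' y = s y)
    ((tlength (s i)).+1 * (20 * M)).
Proof.
move=> ij; have ji : j != i by rewrite eq_sym.
move si: (s i) => l; elim: l s si => [|a _ b IH] s si HM.
  exists s, (ecost s (Var i)).+1; split => //=.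
  - by apply: exec_while_false; rewrite /= si.
  - by rewrite si /=; have := tsize_gt0 (s j); rewrite /= in HM; lia.
set s1 := update s j (Node a (s j)).
set s2 := update s1 i b.
have s1i : s1 i = Node a b by rewrite /s1 update_neq.
have s2i : s2 i = b by rewrite /s2 update_eq.
have s2j : s2 j = Node a (s j) by rewrite /s2 update_neq // /s1 update_eq.
rewrite /= in HM.
have [|s3 [t3 [E3 [e3 f3] l3]]] := IH s2 s2i.
  by rewrite s2j /=; lia.
do 2 eexists; split.
- apply: exec_while_true E3; first by rewrite /= si.
  apply: exec_seq; first exact: exec_assign.
  have -> : eval s (ENode (EHd (Var i)) (Var j)) = Node a (s j) by rewrite /= si.
  have -> : s2 = update s1 i (eval s1 (ETl (Var i))) by rewrite /= s1i.
  exact: exec_assign.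
- split; first by rewrite e3 s2j.
  by move=> y yi yj; rewrite f3 // /s2 update_neq // /s1 update_neq.
- move: l3; rewrite /= si /= (update_neq _ _ ij) si /=; lia.
Qed.

Fixpoint tfoldl (h : tree -> tree -> tree) (z l : tree) : tree :=
  if l is Node x l' then tfoldl h (h x z) l' else z.

Lemma tfoldl_revcat h z l r :
  tfoldl h z (trevcat l r) = tfoldl h (tfoldr h z l) r.
Proof. by elim: l r => //= x _ l IH r; rewrite IH. Qed.

Lemma tsize_revcat l r : tsize (trevcat l r) <= tsize l + tsize r.
Proof. by elim: l r => [|a _ b IH] r /=; [lia|apply: leq_trans (IH _) _ => /=; lia]. Qed.

(** [l2] is the part consumed so far, in its original order. The accumulator is thus always a value
    of [tfoldr], to which the size bound applies. *)
Lemma runs_foldl ch kh dh K (h : tree -> tree -> tree -> tree) z N M s l2 :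
  0 < kh -> kh <= K ->
  (forall s, runs ch s (fun s' => s' 0 = h (hd (s 0)) (hd (tl (s 0))) (tl (tl (s 0)))
       /\ forall y, kh <= y -> s' y = s y) ((tsize (s 0)).+2 ^ dh)) ->
  (forall l, tsize l <= N -> tsize (tfoldr (h (s K)) z l) <= M) ->
  tsize (s K) <= M -> N <= M ->
  s K.+3 = tfoldr (h (s K)) z l2 -> tsize l2 + tsize (s K.+2) <= N ->
  runs (While (Var K.+2)
     (Seq (Assign 0 (ENode (Var K) (ENode (EHd (Var K.+2)) (Var K.+3))))
     (Seq ch (Seq (Assign K.+3 (Var 0)) (Assign K.+2 (ETl (Var K.+2))))))) s
    (fun s' => s' K.+3 = tfoldl (h (s K)) (s K.+3) (s K.+2) /\
       forall y, K.+3 < y -> s' y = s y)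
    ((tlength (s K.+2)).+1 * (20 * M + 20 + (3 * M).+4 ^ dh)).
Proof.
move=> kh0 khK Rh bnd aM NM; move sr: (s K.+2) => r.
elim: r s l2 sr bnd aM => [|x _ r IH] s l2 sr bnd aM st HN.
  exists s, (ecost s (Var K.+2)).+1; split => //=.
  - by apply: exec_while_false; rewrite /= sr.
  - by rewrite sr /=; lia.
set a := s K; set z2 := s K.+3.
have z2M : tsize z2 <= M by rewrite /z2 st bnd //; lia.
rewrite /= in HN.
set s1 := update s 0 (Node a (Node x z2)).
have [s2 [t2 [E2 [e2 f2] l2']]] := Rh s1.
rewrite /s1 update_eq /= -/s1 in e2 l2'.
have f2' y : K <= y -> s2 y = s y.
  by move=> Ky; rewrite f2 /s1 ?update_neq //; lia.
set s3 := update s2 K.+3 (h a x z2).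
set s4 := update s3 K.+2 r.
have s4a : s4 K = a by rewrite /s4 update_neq ?/s3 ?update_neq ?f2' //; lia.
have s4r : s4 K.+2 = r by rewrite /s4 update_eq.
have s4z : s4 K.+3 = h a x z2 by rewrite /s4 update_neq ?/s3 ?update_eq //; lia.
have [||||s5 [t5 [E5 [e5 f5] l5]]] := IH s4 (Node x l2) s4r.
- by rewrite s4a.
- by rewrite s4a.
- by rewrite s4z s4a /= -st.
- by rewrite /=; lia.
have zM : tsize (h a x z2) <= M.
  by rewrite /z2 st -[h _ _ _]/(tfoldr (h a) z (Node x l2)); apply: bnd => /=; lia.
do 2 eexists; split.
- apply: exec_while_true E5; first by rewrite /= sr.
  apply: exec_seq; first exact: exec_assign.
  have -> : eval s (ENode (Var K) (ENode (EHd (Var K.+2)) (Var K.+3))) = Node a (Node x z2).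
    by rewrite /= sr.
  apply: exec_seq; first exact: E2.
  apply: exec_seq; first exact: exec_assign.
  have -> : update s2 K.+3 (eval s2 (Var 0)) = s3 by rewrite /= e2.
  have -> : s4 = update s3 K.+2 (eval s3 (ETl (Var K.+2))).
    by rewrite /= /s3 update_neq ?f2' ?sr //; lia.
  exact: exec_assign.
- split; first by rewrite e5 s4a s4z.
  by move=> y hy; rewrite f5 // /s4 update_neq /s3 ?update_neq ?f2' //; lia.
- have s3r : s3 K.+2 = Node x r by rewrite /s3 update_neq ?f2' //; lia.
  have t2' : t2 <= (3 * M).+4 ^ dh.
    apply: leq_trans l2' _; case: (dh) => // d; rewrite leq_exp2r // !ltnS.
    by rewrite -/a in aM *; lia.
  rewrite /= s3r sr /= e2 -/a -/z2; rewrite /= in l5 *.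
  rewrite mulSn; rewrite -/a in aM; lia.
Qed.

(** The bound on the accumulator is indispensable: a step that doubles it would give exponential
    size. *)
Lemma polytime_foldr h z l :
  polytime (fun b => h (hd b) (hd (tl b)) (tl (tl b))) -> polytime z -> polytime l ->
  (exists2 G, poly_bounded G &
    forall a l2, tsize (tfoldr (h a) (z a) l2) <= G (tsize a + tsize l2)) ->
  polytime (fun a => tfoldr (h a) (z a) (l a)).
Proof.
move=> [ch [kh [dh [kh0 Rh Sh]]]] [cz [kz [dz [kz0 Rz Sz]]]] [cl [kl [dl [kl0 Rl Sl]]]].
move=> [G0 [dG HG] bnd0].
have {bnd0}bnd a l2 : tsize (tfoldr (h a) (z a) l2) <= (tsize a + tsize l2).+2 ^ dG.
  exact: leq_trans (bnd0 _ _) (HG _).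
(* [K] keeps the argument; the next three variables hold the list, its reversal and the
   accumulator. *)
set K := kh + kz + kl.
pose N m := m.+2 ^ dl + 2.
pose M m := (m + N m).+2 ^ dG + N m + m.+2 ^ dz + m + 10.
pose B m := (N m).+1 * (20 * M m + 20 + (3 * M m).+4 ^ dh) + 40 * N m * M m + 40 * M m.
have pbN : poly_bounded N by rewrite /N; pbound.
have pbM : poly_bounded M by rewrite /M; pbound.
apply: (@polytimeI _ (Seq (Assign K (Var 0))
  (Seq (Seq (Assign 0 (Var K)) (Seq cl (Assign K.+1 (Var 0))))
  (Seq (Seq (Assign 0 (Var K)) (Seq cz (Assign K.+3 (Var 0))))
  (Seq (Assign K.+2 ELeaf)
  (Seq (While (Var K.+1) (Seq (Assign K.+2 (ENode (EHd (Var K.+1)) (Var K.+2)))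
                              (Assign K.+1 (ETl (Var K.+1)))))
  (Seq (While (Var K.+2)
     (Seq (Assign 0 (ENode (Var K) (ENode (EHd (Var K.+2)) (Var K.+3))))
     (Seq ch (Seq (Assign K.+3 (Var 0)) (Assign K.+2 (ETl (Var K.+2)))))))
  (Assign 0 (Var K.+3)))))))) K.+4
  (fun m => 20 * B m) (fun m => (m + N m).+2 ^ dG)).
- by [].
- move=> s; set m := tsize (s 0).
  have lN : tsize (l (s 0)) + 2 <= N m by rewrite /N leq_add2r Sl.
  have HB1 : 40 * M m <= B m by rewrite /B; lia.
  have HB2 : (N m).+1 * (20 * M m + 20 + (3 * M m).+4 ^ dh) <= B m by rewrite /B; lia.
  have HB3 : 40 * N m * M m <= B m by rewrite /B; lia.
  have HM : [/\ m.+2 ^ dl < M m, m.+2 ^ dz <= M m, m <= M m, N m <= M m & 10 <= M m].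
    by rewrite /M; split; rewrite /N; lia.
  case: HM => HM1 HM2 HM3 HM4 HM5.
  have bndM l2 : tsize l2 <= N m -> tsize (tfoldr (h (s 0)) (z (s 0)) l2) <= M m.
    move=> lN2; apply: leq_trans (bnd _ _) _; rewrite /M.
    apply: (@leq_trans ((m + N m).+2 ^ dG)); last by lia.
    by case: (dG) => // d; rewrite leq_exp2r // !ltnS leq_add2l.
  apply: (@runs_seq _ _ _ (fun s1 => s1 K = s 0 /\ forall y, y != K -> s1 y = s y) _ m.+2 (14 * B m)).
  + apply: runs_assign => /=; last by rewrite -/m; lia.
    by rewrite update_eq; split=> // y yK; rewrite update_neq.
  + move=> s1 [e1 f1].
    apply: (runs_seq (@runs_save cl l kl dl K K.+1 s1 kl0 _ _ Rl Sl) (T2 := 12 * B m));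
      [by rewrite /K; lia|by []| |by rewrite e1 -/m; lia].
    move=> s2 [e2 f2].
    have s2K : s2 K = s 0 by rewrite f2 ?e1 // /K; lia.
    rewrite e1 in e2.
    apply: (runs_seq (@runs_save cz z kz dz K K.+3 s2 kz0 _ _ Rz Sz) (T2 := 10 * B m));
      [by rewrite /K; lia|by lia| |by rewrite s2K -/m; lia].
    move=> s3 [e3 f3]; rewrite s2K in e3.
    have s3K : s3 K = s 0 by rewrite f3 ?s2K // /K; lia.
    have s3l : s3 K.+1 = l (s 0) by rewrite f3 ?e2 // /K; lia.
    apply: (@runs_seq _ _ _ (fun s' => s' = update s3 K.+2 Leaf) _ 2 (9 * B m)); last by lia.
      exact: runs_assign.
    move=> s4 ->{s4}; set s4 := update _ _ _.
    have s4K : s4 K = s 0 by rewrite /s4 update_neq //; lia.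
    have s4l : s4 K.+1 = l (s 0) by rewrite /s4 update_neq //; lia.
    have s4z : s4 K.+3 = z (s 0) by rewrite /s4 update_neq // /K; lia.
    have s4r : s4 K.+2 = Leaf by rewrite /s4 update_eq.
    apply: (runs_seq (@runs_reverse K.+1 K.+2 s4 (N m) _ _) (T2 := 8 * B m)).
    * by lia.
    * by rewrite s4l s4r /=; lia.
    * move=> s5 [e5 f5]; rewrite s4l s4r in e5.
      have s5K : s5 K = s 0 by rewrite f5 //; lia.
      have s5z : s5 K.+3 = z (s 0) by rewrite f5 //; lia.
      apply: (runs_seq (@runs_foldl ch kh dh K h (z (s 0)) ((N m)) (M m) s5 Leaf _ _ _ _ _ _ _ _)
         (T2 := B m)) => //.
      - by rewrite /K; lia.
      - by rewrite s5K.
      - by rewrite s5K.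
      - by rewrite e5; have := tsize_revcat (l (s 0)) Leaf; rewrite /=; lia.
      - move=> s6 [e6 f6]; rewrite s5K s5z e5 tfoldl_revcat /= in e6.
        apply: runs_assign => /=; last first.
          by rewrite e6; have := bndM (l (s 0)); lia.
        rewrite update_eq e6; split=> // y hy.
        by rewrite update_neq ?f6 ?f5 ?/s4 ?update_neq ?f3 ?f2 ?f1 //; rewrite /K in hy *; lia.
      - rewrite e5 tlength_revcat /= addn0.
        have : (tlength (l (s 0))).+1 <= (N m).+1 by have := tlength_size (l (s 0)); lia.
        move=> /(leq_mul)/(_ (leqnn (20 * M m + 20 + (3 * M m).+4 ^ dh))); lia.
    * rewrite s4l; have : (tlength (l (s 0))).+1 <= N m by have := tlength_size (l (s 0)); lia.
      move=> /(leq_mul)/(_ (leqnn (20 * N m))).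
      have : N m * (20 * N m) <= 20 * N m * M m by rewrite mulnC leq_mul.
      lia.
  + by lia.
- by rewrite /B /M /N; pbound.
- move=> a /=; apply: leq_trans (bnd _ _) _.
  case: (dG) => // d; rewrite leq_exp2r // !ltnS leq_add2l /N.
  by apply: leq_trans (Sl _) _; lia.
- by rewrite /N; pbound.
Qed.

(** * Tree programs *)

Definition polytime2 (p : tree -> tree -> tree) :=
  polytime (fun b => p (hd b) (tl b)).
Definition polytime3 (p : tree -> tree -> tree -> tree) :=
  polytime (fun b => p (hd b) (hd (tl b)) (tl (tl b))).
Definition polytime4 (p : tree -> tree -> tree -> tree -> tree) :=
  polytime (fun b => p (hd b) (hd (tl b)) (hd (tl (tl b))) (tl (tl (tl b)))).

Lemma polytime2_comp p f g :
  polytime2 p -> polytime f -> polytime g -> polytime (fun a => p (f a) (g a)).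
Proof.
by move=> Hp Hf Hg; apply: (polytime_comp (g := fun a => Node (f a) (g a)) Hp);
  apply: polytime_node.
Qed.

Lemma polytime3_comp p f g h :
  polytime3 p -> polytime f -> polytime g -> polytime h ->
  polytime (fun a => p (f a) (g a) (h a)).
Proof.
move=> Hp Hf Hg Hh.
by apply: (polytime_comp (g := fun a => Node (f a) (Node (g a) (h a))) Hp);
  do 2 apply: polytime_node => //.
Qed.

Lemma polytime4_comp p f g h k :
  polytime4 p -> polytime f -> polytime g -> polytime h -> polytime k ->
  polytime (fun a => p (f a) (g a) (h a) (k a)).
Proof.
move=> Hp Hf Hg Hh Hk.
apply: (polytime_comp (g := fun a => Node (f a) (Node (g a) (Node (h a) (k a)))) Hp).
by do 3 apply: polytime_node => //.
Qed.

Lemma tsize_tfoldr h z l (B : nat) :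
  (forall x r, tsize x <= tsize l -> tsize (h x r) <= tsize r + B) ->
  tsize (tfoldr h z l) <= tsize z + tsize l * B.
Proof.
elim: l => [|x _ l IH] hB /=; first by lia.
have := hB x (tfoldr h z l) _; rewrite /=.
have /IH : forall y r, tsize y <= tsize l -> tsize (h y r) <= tsize r + B.
  by move=> y r yl; apply: hB => /=; lia.
nia.
Qed.

(** The increment in each round does not depend on the accumulator, so the growth is additive and
    the total is at most rounds times increment. *)
Lemma polytime_foldr_growth h z l d :
  polytime3 h -> polytime z -> polytime l ->
  (forall a x r, tsize (h a x r) <= tsize r + (tsize a + tsize x).+2 ^ d) ->
  polytime (fun a => tfoldr (h a) (z a) (l a)).
Proof.
move=> Hh Hz Hl gr; apply: polytime_foldr => //.
case: Hz => [_ [_ [dz [_ _ Sz]]]].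
exists (fun m => m.+2 ^ dz + m * m.+2 ^ d); first by pbound.
move=> a l2; apply: leq_trans (@tsize_tfoldr _ _ _ ((tsize a + tsize l2).+2 ^ d) _) _.
  move=> x r xl; apply: leq_trans (gr _ _ _) _; rewrite leq_add2l.
  by case: (d) => // d'; rewrite leq_exp2r // !ltnS leq_add2l.
apply: leq_add; last by rewrite leq_mul2r leq_addl orbT.
apply: leq_trans (Sz _) _; case: (dz) => // d'.
by rewrite leq_exp2r // !ltnS leq_addr.
Qed.

(** * Truth values, lists and unary arithmetic *)

Definition tT : tree := Node Leaf Leaf.
Definition tif c a b : tree := if truth c then a else b.
Definition tnot a := tif a Leaf tT.
Definition tand a b := tif a b Leaf.
Definition tor a b := tif a tT b.

Lemma truth_not a : truth (tnot a) = ~~ truth a. Proof. by rewrite /tnot /tif; case: ifP. Qed.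
Lemma truth_and a b : truth (tand a b) = truth a && truth b.
Proof. by rewrite /tand /tif; case: ifP. Qed.
Lemma truth_or a b : truth (tor a b) = truth a || truth b.
Proof. by rewrite /tor /tif; case: ifP. Qed.

Definition tfilter p l := tfoldr (fun x r => tif (p x) (Node x r) r) Leaf l.
Definition tmap f l := tfoldr (fun x r => Node (f x) r) Leaf l.
Definition tapp l1 l2 := tfoldr Node l2 l1.
Definition tflatmap f l := tfoldr (fun x r => tapp (f x) r) Leaf l.
(** Truncated subtraction of lengths. It compares unary numbers, but also arbitrary lists; so a
    potential can be any list of the right length. *)
Definition tsub a b := tfoldr (fun _ r => tl r) a b.
Definition tlt a b := tsub b a.
Definition teq a b := tnot (tor (tsub a b) (tsub b a)).

Lemma tsize_filter p l : tsize (tfilter p l) <= tsize l.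
Proof. by elim: l => //= x _ l IH; rewrite /tfilter /= /tif; case: ifP => _ /=; rewrite -/(tfilter p l); lia. Qed.

Lemma tsize_app l1 l2 : tsize (tapp l1 l2) <= tsize l1 + tsize l2.
Proof. by elim: l1 => [|x _ l IH] /=; rewrite /tapp /= -/(tapp _ _); lia. Qed.

(** Proofs of polynomial time follow the syntax of the program: primitives here, and in [pt_app] the
    functions registered in [pt], whose arguments become new goals. *)
Ltac pt_step :=
  match goal with
  | H : polytime ?F |- polytime ?F => exact: H
  | |- polytime (fun a => a) => exact: polytime_id
  | |- polytime id => exact: polytime_id
  | |- polytime hd => exact: (polytime_hd polytime_id)
  | |- polytime tl => exact: (polytime_tl polytime_id)
  | |- polytime (fun _ => Leaf) => exact: polytime_leaf
  | |- polytime (fun a => hd (@?f a)) => refine (@polytime_hd f _)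
  | |- polytime (fun a => tl (@?f a)) => refine (@polytime_tl f _)
  | |- polytime (fun a => Node (@?f a) (@?g a)) => refine (@polytime_node f g _ _)
  | |- polytime (fun a => tif (@?h a) (@?f a) (@?g a)) =>
      refine (@polytime_if h f g _ _ _)
  end.

Create HintDb pt.

Ltac pt_app :=
  match goal with
  | |- polytime (fun a => ?p (@?f a) (@?g a) (@?h a) (@?k a)) =>
      refine (@polytime4_comp p f g h k _ _ _ _ _); first by eauto with pt nocore
  | |- polytime (fun a => ?p (@?f a) (@?g a) (@?h a)) =>
      refine (@polytime3_comp p f g h _ _ _ _); first by eauto with pt nocore
  | |- polytime (fun a => ?p (@?f a) (@?g a)) =>
      refine (@polytime2_comp p f g _ _ _); first by eauto with pt nocore
  | |- polytime (fun a => ?p (@?f a)) =>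
      refine (@polytime_comp p f _ _); first by eauto with pt nocore
  end.

Ltac pt0 := rewrite /polytime2 /polytime3 /polytime4; cbv beta;
  repeat (first [pt_step | pt_app]; cbv beta).

Lemma polytime_const a : polytime (fun=> a).
Proof. by elim: a => [|a Ha b Hb]; pt0. Qed.

Lemma polytime_filter p l :
  polytime2 p -> polytime l -> polytime (fun a => tfilter (p a) (l a)).
Proof.
move=> Hp Hl; apply: (@polytime_foldr_growth (fun a x r => tif (p a x) (Node x r) r)
  (fun=> Leaf) l 1) => //; [|exact: polytime_leaf|].
  by pt0.
by move=> a x r; rewrite /tif; case: ifP => _ /=; lia.
Qed.

(** Absorbs the node that pairs the argument with an entry; strictness leaves room for the node that
    [tmap] adds. *)
Lemma pow_shift m d : m.+3 ^ d < m.+2 ^ (2 * d + 1).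
Proof.
rewrite expnD expnM expn1.
have le : m.+3 ^ d <= (m.+2 ^ 2) ^ d by case: d => // d; rewrite leq_exp2r //; nia.
apply: leq_ltn_trans le _; have : 0 < (m.+2 ^ 2) ^ d by rewrite expn_gt0 expn_gt0.
nia.
Qed.

Lemma polytime_map p l :
  polytime2 p -> polytime l -> polytime (fun a => tmap (p a) (l a)).
Proof.
move=> Hp Hl; have [_ [_ [d [_ _ Sp]]]] := Hp.
apply: (@polytime_foldr_growth (fun a x r => Node (p a x) r) (fun=> Leaf) l (2 * d + 1)) => //;
  [|exact: polytime_leaf|].
  by pt0.
move=> a x r /=; have := Sp (Node a x) => /=.
move: (tsize a + tsize x) => m H.
by have := pow_shift m d; lia.
Qed.

Lemma polytime2_app : polytime2 tapp.
Proof.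
apply: (@polytime_foldr_growth (fun a x r => Node x r) tl hd 1); try by pt0.
by move=> a x r /=; lia.
Qed.

Lemma polytime_flatmap p l :
  polytime2 p -> polytime l -> polytime (fun a => tflatmap (p a) (l a)).
Proof.
move=> Hp Hl; have [_ [_ [d [_ _ Sp]]]] := Hp.
apply: (@polytime_foldr_growth (fun a x r => tapp (p a x) r) (fun=> Leaf) l (2 * d + 1)) => //;
  [|exact: polytime_leaf|].
  by have Happ := polytime2_app; pt0.
move=> a x r; apply: leq_trans (tsize_app _ _) _; have := Sp (Node a x) => /=.
move: (tsize a + tsize x) => m H.
by have := pow_shift m d; lia.
Qed.

Lemma polytime2_sub : polytime2 tsub.
Proof.
apply: (@polytime_foldr_growth (fun a x r => tl r) hd tl 1); try by pt0.
by move=> a x r /=; have := tsize_tl r; lia.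
Qed.

Ltac pt1 :=
  match goal with
  | |- polytime (fun _ => tT) => exact: (polytime_const tT)
  | |- polytime (fun a => tfilter (@?p a) (@?l a)) =>
      refine (@polytime_filter p l _ _); rewrite /polytime2
  | |- polytime (fun a => tmap (@?p a) (@?l a)) =>
      refine (@polytime_map p l _ _); rewrite /polytime2
  | |- polytime (fun a => tflatmap (@?p a) (@?l a)) =>
      refine (@polytime_flatmap p l _ _); rewrite /polytime2
  end.
Ltac pt := rewrite /polytime2 /polytime3 /polytime4; cbv beta;
  repeat (first [pt_step | pt1 | pt_app]; cbv beta).

#[local] Hint Resolve polytime2_app polytime2_sub : pt.

Lemma polytime_not : polytime tnot. Proof. by rewrite /tnot; pt. Qed.
Lemma polytime2_and : polytime2 tand. Proof. by rewrite /tand; pt. Qed.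
Lemma polytime2_or : polytime2 tor. Proof. by rewrite /tor; pt. Qed.
Lemma polytime2_lt : polytime2 tlt. Proof. by rewrite /tlt; pt. Qed.
#[local] Hint Resolve polytime_not polytime2_and polytime2_or polytime2_lt : pt.
Lemma polytime2_eq : polytime2 teq. Proof. by rewrite /teq; pt. Qed.
#[local] Hint Resolve polytime2_eq : pt.

(** * Programs for edges, components and moves *)

Definition tpeq p q := tand (teq (hd p) (hd q)) (teq (tl p) (tl q)).
Lemma polytime2_peq : polytime2 tpeq. Proof. by rewrite /tpeq; pt. Qed.
#[local] Hint Resolve polytime2_peq : pt.

Definition tmem e g := tfilter (tpeq e) g.
Lemma polytime2_mem : polytime2 tmem. Proof. by rewrite /tmem; pt. Qed.
#[local] Hint Resolve polytime2_mem : pt.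

Definition tadj g u w :=
  tfilter (fun e => tor (tpeq e (Node u w)) (tpeq e (Node w u))) g.
Definition tinc g v := tfilter (fun e => tor (teq (hd e) v) (teq (tl e) v)) g.
Lemma polytime3_adj : polytime3 tadj. Proof. by rewrite /tadj; pt. Qed.
Lemma polytime2_inc : polytime2 tinc. Proof. by rewrite /tinc; pt. Qed.
#[local] Hint Resolve polytime3_adj polytime2_inc : pt.

Definition treach_step V g v r :=
  tfilter (fun u => tor (teq u v) (tfilter (tadj g u) r)) V.
(** [V] also serves as the clock: as many rounds as there are vertices reach the fixed point. *)
Definition treach V g v := tfoldr (fun _ r => treach_step V g v r) Leaf V.
Lemma polytime4_reach_step : polytime4 treach_step.
Proof. by rewrite /treach_step; pt. Qed.
#[local] Hint Resolve polytime4_reach_step : pt.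

Lemma polytime3_reach : polytime3 treach.
Proof.
apply: (@polytime_foldr_growth
  (fun a _ r => treach_step (hd a) (hd (tl a)) (tl (tl a)) r) (fun=> Leaf) hd 1); pt.
move=> a x r; apply: leq_trans (tsize_filter _ _) _.
by have := tsize_hd a; lia.
Qed.
#[local] Hint Resolve polytime3_reach : pt.

Definition ttwo l := tand l (tand (tl l) (tnot (tl (tl l)))).
Definition tbad V g v :=
  tnot (tfilter (fun u => tnot (ttwo (tinc g u))) (treach V g v)).
(** Each cycle component is represented by its first vertex in the order of [V], so the length of
    the list counts components, not vertices. *)
Definition tbads V g :=
  tfilter (fun v => tand (teq (hd (treach V g v)) v) (tbad V g v)) V.
Lemma polytime_two : polytime ttwo. Proof. by rewrite /ttwo; pt. Qed.
#[local] Hint Resolve polytime_two : pt.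
Lemma polytime3_bad : polytime3 tbad. Proof. by rewrite /tbad; pt. Qed.
#[local] Hint Resolve polytime3_bad : pt.
Lemma polytime2_bads : polytime2 tbads. Proof. by rewrite /tbads; pt. Qed.
#[local] Hint Resolve polytime2_bads : pt.

(** Filtering the full edge list, rather than adding [p] in front, keeps every state in the order of
    [E], so that an edge set has a single encoding. *)
Definition tswap E g p q :=
  tfilter (fun e => tand (tor (tmem e g) (tpeq e p)) (tnot (tpeq e q))) E.
Lemma polytime4_swap : polytime4 tswap. Proof. by rewrite /tswap; pt. Qed.
#[local] Hint Resolve polytime4_swap : pt.

(* In the searches the environment is the pair of the list of vertices and the
   list of edges. *)
Definition tpsiB env g :=
  tapp (tflatmap (fun v => tsub (Node Leaf tT) (tinc g v)) (hd env)) (tbads (hd env) g).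
Definition tactB env g v := tor (tnot (tl (tinc g v))) (tbad (hd env) g v).
Definition tnxtB env g :=
  tflatmap (fun p => tmap (fun q => Node (hd q) (tswap (tl env) g p q))
                          (tfilter (fun q => teq (tl q) (tl p)) g))
    (tfilter (fun p => tand (tnot (tmem p g)) (tactB env g (hd p))) (tl env)).
Lemma polytime2_psiB : polytime2 tpsiB. Proof. by rewrite /tpsiB; pt. Qed.
Lemma polytime3_actB : polytime3 tactB. Proof. by rewrite /tactB; pt. Qed.
#[local] Hint Resolve polytime2_psiB polytime3_actB : pt.
Lemma polytime2_nxtB : polytime2 tnxtB. Proof. by rewrite /tnxtB; pt. Qed.
#[local] Hint Resolve polytime2_nxtB : pt.

Definition tdel g q := tfilter (fun e => tnot (tpeq e q)) g.
Lemma polytime2_del : polytime2 tdel. Proof. by rewrite /tdel; pt. Qed.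
#[local] Hint Resolve polytime2_del : pt.

Definition tpsiC (env g : tree) := g.
Definition tactC (env g v : tree) := Leaf.
Definition tnxtC env g :=
  tmap (fun q => Node (hd q) (tdel g q))
    (tfilter (fun q => tand (tl (tl (tinc g (hd q))))
                            (tnot (tbads (hd env) (tdel g q)))) g).
Lemma polytime2_psiC : polytime2 tpsiC. Proof. by rewrite /tpsiC; pt. Qed.
Lemma polytime3_actC : polytime3 tactC. Proof. by rewrite /tactC; pt. Qed.
Lemma polytime2_nxtC : polytime2 tnxtC. Proof. by rewrite /tnxtC; pt. Qed.
#[local] Hint Resolve polytime2_psiC polytime3_actC polytime2_nxtC : pt.

Definition tactD (env g v : tree) := tnot (tinc g v).
Definition tpsiD env g := tfilter (tactD env g) (hd env).
Definition tnxtD env g :=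
  tflatmap (fun p => tmap (fun q => Node (tl q) (tswap (tl env) g p q))
                          (tfilter (fun q => teq (hd q) (hd p)) g))
    (tfilter (fun p => tactD env g (tl p)) (tl env)).
Lemma polytime3_actD : polytime3 tactD. Proof. by rewrite /tactD; pt. Qed.
#[local] Hint Resolve polytime3_actD : pt.
Lemma polytime2_psiD : polytime2 tpsiD. Proof. by rewrite /tpsiD; pt. Qed.
Lemma polytime2_nxtD : polytime2 tnxtD. Proof. by rewrite /tnxtD; pt. Qed.
#[local] Hint Resolve polytime2_psiD polytime2_nxtD : pt.

(** * The search as a tree program *)

Section TreeSearch.
Variables (nxt psi : tree -> tree -> tree) (act : tree -> tree -> tree -> tree).

Definition timproving env L c := tlt (psi env (tl c)) (psi env (hd L)).
Definition textending env L c :=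
  tand (tnot (tlt (psi env (hd L)) (psi env (tl c))))
    (tand (act env (tl c) (hd c))
      (tnot (tfilter (fun g => act env g (hd c)) L))).
(* The new state is reread along the list of edges; this changes nothing, but
   makes the bound on its size evident. *)
Definition tstate env c := tfilter (fun e => tmem e (tl c)) (tl env).
Definition tstep2 env L imp ext :=
  tif imp (Node (tstate env (hd imp)) Leaf)
    (tif ext (Node (tstate env (hd ext)) L) L).
Definition tstep env L :=
  tstep2 env L
    (tfilter (timproving env L) (tflatmap (nxt env) L))
    (tfilter (textending env L) (tflatmap (nxt env) L)).
Definition tsearch env g clock :=
  hd (tfoldr (fun _ L => tstep env L) (Node g Leaf) clock).

Hypothesis (Hnxt : polytime2 nxt) (Hpsi : polytime2 psi) (Hact : polytime3 act).

Lemma polytime2_step : polytime2 tstep.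
Proof. by rewrite /tstep /tstep2 /timproving /textending /tstate; pt. Qed.

Lemma polytime3_search : polytime3 tsearch.
Proof.
apply: polytime_hd.
have Hstep := polytime2_step.
apply: (@polytime_foldr_growth (fun a _ L => tstep (hd a) L)
  (fun a => Node (hd (tl a)) Leaf) (fun a => tl (tl a)) 1); pt.
move=> a x r; rewrite /tstep /tstep2 /tif.
have := tsize_tl (hd a); have := tsize_hd a; rewrite expn1.
case: ifP => _ /=; last case: ifP => _ /=; last by lia.
  have := tsize_filter (fun e => tmem e (tl (hd (tfilter (timproving (hd a) r) (tflatmap (nxt (hd a)) r))))) (tl (hd a)).
  by rewrite /tstate; have := tsize_gt0 r; lia.
have := tsize_filter (fun e => tmem e (tl (hd (tfilter (textending (hd a) r) (tflatmap (nxt (hd a)) r))))) (tl (hd a)).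
by rewrite /tstate; lia.
Qed.

End TreeSearch.
#[local] Hint Resolve polytime3_search : pt.

Definition tlen a := tmap (fun=> Leaf) a.
(* The fold runs from the last entry to the first, so the counter goes down. *)
Definition tindex_step x st :=
  Node (tl (hd st)) (Node (Node (tl (hd st)) x) (tl st)).
Definition tindex a := tl (tfoldr tindex_step (Node (tlen a) Leaf) a).
Lemma polytime_len : polytime tlen. Proof. by rewrite /tlen; pt. Qed.
#[local] Hint Resolve polytime_len : pt.

(** The growth criterion does not apply, because a new entry contains the counter, a part of the
    accumulator. But the counter never grows, so the size is bounded directly. *)
Lemma polytime_index : polytime tindex.
Proof.
apply: polytime_tl.
apply: (@polytime_foldr (fun _ => tindex_step) (fun a => Node (tlen a) Leaf) id).
- by rewrite /tindex_step; pt.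
- by pt.
- by pt.
have [_ [_ [d [_ _ Sl]]]] := polytime_len.
exists (fun m => m.+2 ^ d + 2 + 3 * m * (m + m.+2 ^ d + 10)); first by pbound.
have hdz z l : tsize (hd (tfoldr tindex_step z l)) <= tsize z.
  elim: l => [|x _ l IH] /=; first exact: tsize_hd.
  by have := tsize_tl (hd (tfoldr tindex_step z l)); lia.
have sz z l : tsize (tfoldr tindex_step z l) <= tsize z + 3 * tsize l * (tsize z + tsize l + 5).
  elim: l => [|x _ l IH] /=; first by lia.
  have := hdz z l; have := tsize_tl (hd (tfoldr tindex_step z l)).
  have := tsize_tl (tfoldr tindex_step z l); nia.
move=> a l2; have := sz (Node (tlen a) Leaf) l2.
have zd : tsize (Node (tlen a) Leaf) <= (tsize a).+2 ^ d + 2 by have := Sl a => /=; lia.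
move: (tsize (Node _ _)) zd => s zd.
have le : (tsize a).+2 ^ d <= (tsize a + tsize l2).+2 ^ d.
  by case: (d) => // d'; rewrite leq_exp2r // !ltnS leq_addr.
nia.
Qed.
#[local] Hint Resolve polytime_index : pt.

(* An edge xy with deg x = 4 and deg y = 3 is stored as Node x y.  The search
   starts from the graph that omits the first edge at each y. *)
Definition trows Z :=
  tfilter (fun z => tand (tl (tl (tl z))) (tnot (tl (tl (tl (tl z)))))) Z.
Definition tedges Z := tflatmap (fun z => tmap (fun x => Node x (hd z)) (tl z)) (trows Z).
Definition tstart Z :=
  tflatmap (fun z => tmap (fun x => Node x (hd z)) (tl (tl z))) (trows Z).
Definition tenv Z := Node (tmap hd Z) (tedges Z).
(** With n vertices and m edges the length is (m + 3n + 1)(n + 1). This covers p(n + 1) + n rounds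
    for every potential p up to m + 3n, a bound valid in all three stages. *)
Definition tclock env :=
  tflatmap (fun=> Node Leaf (hd env))
    (tapp (tl env) (tapp (hd env) (tapp (hd env) (tapp (hd env) tT)))).
Definition toutput Z f := tmap (fun z => tfilter (tadj f (hd z)) (tl z)) Z.
Lemma polytime_rows : polytime trows. Proof. by rewrite /trows; pt. Qed.
#[local] Hint Resolve polytime_rows : pt.
Lemma polytime_edges : polytime tedges. Proof. by rewrite /tedges; pt. Qed.
Lemma polytime_start : polytime tstart. Proof. by rewrite /tstart; pt. Qed.
#[local] Hint Resolve polytime_edges polytime_start : pt.
Lemma polytime_env : polytime tenv. Proof. by rewrite /tenv; pt. Qed.
Lemma polytime_clock : polytime tclock. Proof. by rewrite /tclock; pt. Qed.
Lemma polytime2_output : polytime2 toutput. Proof. by rewrite /toutput; pt. Qed.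
#[local] Hint Resolve polytime_env polytime_clock polytime2_output : pt.

Definition tfactor Z :=
  tsearch tnxtD tpsiD tactD (tenv Z)
   (tsearch tnxtC tpsiC tactC (tenv Z)
     (tsearch tnxtB tpsiB tactB (tenv Z) (tstart Z) (tclock (tenv Z)))
     (tclock (tenv Z)))
   (tclock (tenv Z)).
Definition tmain a := toutput (tindex a) (tfactor (tindex a)).

Lemma polytime_factor : polytime tfactor. Proof. by rewrite /tfactor; pt. Qed.
#[local] Hint Resolve polytime_factor : pt.
Lemma polytime_main : polytime tmain. Proof. by rewrite /tmain; pt. Qed.

(** * Local search *)

(* A move (v, g) leads to the state g and is meant to make the vertex v active.
   The search keeps a list of states of equal potential, newest first, each of
   which makes a vertex active that was inactive in all earlier ones. *)
Section Search.
Variables (V : finType) (S : eqType) (nxt : S -> seq (V * S)) (psi : S -> nat).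
Variable act : S -> pred V.

Definition covered (L : seq S) (v : V) := has (fun g => act g v) L.
Definition moves (L : seq S) := flatten [seq nxt g | g <- L].
(** [d] is just the default of [head]. All states of the list share one potential, so comparing with
    the newest is enough. *)
Definition improving d L (c : V * S) := psi c.2 < psi (head d L).
Definition extending d L (c : V * S) :=
  ~~ (psi (head d L) < psi c.2) && (act c.2 c.1 && ~~ covered L c.1).
Definition step d (L : seq S) : seq S :=
  if [seq c <- moves L | improving d L c] is c :: _ then [:: c.2]
  else if [seq c <- moves L | extending d L c] is c :: _ then c.2 :: L else L.

(** What the search has collected since its last improvement, which led to [g0]. A new state may
    come from any earlier one, so the states form a tree rather than a path of moves. *)
Inductive chain (g0 : S) : seq S -> Prop :=
  | chain_base : chain g0 [:: g0]
  | chain_ext g a g' L : chain g0 L -> g' \in L -> (a, g) \in nxt g' ->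
      psi g = psi g0 -> act g a -> ~~ covered L a -> chain g0 (g :: L).

Definition stuck (d : S) L :=
  forall c, c \in moves L -> ~~ improving d L c /\ ~~ extending d L c.

Lemma chain_psi g0 d L : chain g0 L -> psi (head d L) = psi g0.
Proof. by case. Qed.

Lemma chain_psi_mem g0 L : chain g0 L -> forall g, g \in L -> psi g = psi g0.
Proof.
elim=> [|g a g' {}L _ IH _ _ ps _ _] h; rewrite inE; first by move/eqP ->.
by case/predU1P => [->|/IH].
Qed.

Lemma chain_mem g0 L : chain g0 L -> g0 \in L.
Proof. by elim=> [|g a g' {}L _ IH *]; rewrite inE ?eqxx // IH orbT. Qed.

Variable Inv : S -> Prop.
Hypothesis Inv_nxt : forall g c, Inv g -> c \in nxt g -> Inv c.2.

Lemma chain_inv g0 L : Inv g0 -> chain g0 L -> forall g, g \in L -> Inv g.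
Proof.
move=> I0; elim=> [g|g a g' {}L _ IH g'L nx _ _ _ h]; first by rewrite inE => /eqP ->.
by rewrite inE => /predU1P [->|/IH //]; apply: Inv_nxt nx; apply: IH.
Qed.

(** A lexicographic order in one number: a unit of potential outweighs all vertices that an
    improvement may uncover again. *)
Definition measure d L := psi (head d L) * #|V|.+1 + #|[set v | ~~ covered L v]|.

Lemma step_chain d g0 L : Inv g0 -> chain g0 L ->
  (step d L = L /\ stuck d L) \/
  (exists2 g1, Inv g1 & chain g1 (step d L)) /\ measure d (step d L) < measure d L.
Proof.
move=> I0 cL; rewrite /step.
case E1: [seq c <- moves L | improving d L c] => [|c s].
  case E2: [seq c <- moves L | extending d L c] => [|c s].
    left; split=> // c cm; split; apply/negP => H.
      by have : c \in [::] by rewrite -E1 mem_filter H.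
    by have : c \in [::] by rewrite -E2 mem_filter H.
  right; have : c \in c :: s by rewrite mem_head.
  rewrite -E2 mem_filter => /andP [/and3P [le1 ac nc] cm].
  have nI : ~~ improving d L c.
    by apply/negP => H; have : c \in [::] by rewrite -E1 mem_filter H.
  have pE : psi c.2 = psi (head d L) by move: le1 nI; rewrite /improving; lia.
  have [g' g'L cg'] : exists2 g', g' \in L & c \in nxt g' by apply/flatten_mapP.
  split.
    exists g0 => //; apply: (@chain_ext _ _ c.1 g') => //.
      by rewrite -surjective_pairing.
    by rewrite pE (chain_psi d cL).
  rewrite /measure /= pE ltn_add2l; apply: proper_card; apply/properP; split.
    by apply/subsetP => v; rewrite !inE negb_or => /andP [].
  by exists c.1; rewrite inE //= ac.
right; have : c \in c :: s by rewrite mem_head.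
rewrite -E1 mem_filter => /andP [lt1 cm].
have [g' g'L cg'] : exists2 g', g' \in L & c \in nxt g' by apply/flatten_mapP.
split.
  exists c.2; last exact: chain_base.
  by apply: Inv_nxt cg'; apply: chain_inv cL _ g'L.
have : #|[set v | ~~ covered [:: c.2] v]| <= #|V| by apply: max_card.
move: lt1; rewrite /measure /improving [head d [:: _]]/=; set A := psi _; set B := psi _ => AB.
have : A.+1 * #|V|.+1 <= B * #|V|.+1 by rewrite leq_mul2r AB orbT.
by rewrite mulSn; lia.
Qed.

Lemma iter_step_stuck d N L g0 : Inv g0 -> chain g0 L -> measure d L <= N ->
  exists2 g1, Inv g1 & chain g1 (iter N (step d) L) /\ stuck d (iter N (step d) L).
Proof.
elim: N L g0 => [|N IH] L g0 I0 cL le.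
  case: (step_chain d I0 cL) => [[_ st]|[_]]; last by lia.
  by exists g0.
case: (step_chain d I0 cL) => [[E st]|[[g1 I1 c1] lt]]; last first.
  by rewrite iterSr; apply: IH c1 _ => //; lia.
exists g0 => //.
suff -> : iter N.+1 (step d) L = L by [].
by elim: {IH le} N.+1 => //= n ->.
Qed.

Lemma search_stuck g N : Inv g -> psi g * #|V|.+1 + #|V| <= N ->
  exists2 g1, Inv g1 &
    chain g1 (iter N (step g) [:: g]) /\ stuck g (iter N (step g) [:: g]).
Proof.
move=> Ig le; apply: (iter_step_stuck (g0 := g)) => //; first exact: chain_base.
by apply: leq_trans le; rewrite /measure leq_add2l max_card.
Qed.

End Search.

(** * Degrees, components and 2-regular components *)

Section Graph.
Variable V : finType.
Implicit Types (G h : {set V * V}) (p q : V * V) (u v w x y : V) (C D : {set V}).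

Definition inc p v := (p.1 == v) || (p.2 == v).
Definition adj G : rel V := fun u w => ((u, w) \in G) || ((w, u) \in G).
Definition deg G v := #|[set p in G | inc p v]|.
Definition gcomp G v := [set u | connect (adj G) v u].
(* A bad component is a cycle: a component in which all degrees are 2. *)
Definition bad G v := [forall u, connect (adj G) v u ==> (deg G u == 2)].
Definition bads G := [set gcomp G v | v in [set v | bad G v]].
Definition closed_in G C := forall p, p \in G -> (p.1 \in C) = (p.2 \in C).
Definition loopless G := forall p, p \in G -> p.1 != p.2.
Definition swap G p q := (p |: G) :\ q.

Lemma adj_sym G : symmetric (adj G).
Proof. by move=> u w; rewrite /adj orbC. Qed.

Lemma conn_sym G : connect_sym (adj G).
Proof. exact/sym_connect_sym/adj_sym. Qed.

Lemma connect_closed G C v u :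
  closed_in G C -> v \in C -> connect (adj G) v u -> u \in C.
Proof.
move=> cC vC /connectP [s ps ->]; elim: s v vC ps => //= w s IH v vC /andP [a].
by apply: IH; case/orP: a => /cC /= H; rewrite -?H // H.
Qed.

Lemma closed_gcomp G v : closed_in G (gcomp G v).
Proof.
move=> [a b] pG; rewrite !inE /=.
have ab : connect (adj G) a b by apply: connect1; rewrite /adj pG.
apply/idP/idP => H; first exact: connect_trans ab.
by apply: connect_trans H _; rewrite conn_sym.
Qed.

Lemma badP G v : reflect (forall u, connect (adj G) v u -> deg G u = 2) (bad G v).
Proof.
apply: (iffP forallP) => H u; first by move/implyP: (H u) => H' /H' /eqP.
by apply/implyP => /H /eqP.
Qed.

Lemma bad_connect G v u : connect (adj G) v u -> bad G v = bad G u.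
Proof.
move=> vu; apply/badP/badP => H w c; apply: H; first exact: connect_trans c.
by apply: connect_trans c; rewrite conn_sym.
Qed.

Lemma bad_deg G v : bad G v -> deg G v = 2.
Proof. by move/badP; apply. Qed.

Lemma gcomp_eq G v u : (gcomp G v == gcomp G u) = connect (adj G) v u.
Proof.
apply/eqP/idP => [E|c]; first by rewrite conn_sym; have : v \in gcomp G u;
  [by rewrite -E inE|rewrite inE].
by apply/setP => w; rewrite !inE (same_connect (@conn_sym G) c).
Qed.

(** The handshake lemma for a union of components: each edge inside counts at its two distinct
    ends. *)
Lemma sum_deg_closed G C : loopless G -> closed_in G C ->
  \sum_(v in C) deg G v = 2 * #|[set p in G | p.1 \in C]|.
Proof.
move=> lG cC.
have E v : deg G v = \sum_(p in G) inc p v.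
  by rewrite /deg -sum1_card big_mkcond [RHS]big_mkcond; apply: eq_bigr => p _;
     rewrite inE; case: (p \in G) => //=; case: (inc p v).
rewrite (eq_bigr (fun v => \sum_(p in G) inc p v)) => [|v _]; last exact: E.
rewrite exchange_big /= -sum1_card big_distrr /= big_mkcond [RHS]big_mkcond /=.
apply: eq_bigr => p _; rewrite inE; case: ifP => //= pG.
rewrite (eq_bigr (fun v => (v == p.1) + (v == p.2))) => [|v _]; last first.
  rewrite /inc ![v == _]eq_sym; have := lG _ pG.
  by case: (p.1 =P v) => [->|_ _] //=; rewrite eq_sym => /negPf ->.
rewrite big_split /= muln1.
have S a : \sum_(v in C) (v == a) = (a \in C).
  case aC: (a \in C).
    by rewrite (bigD1 a) //= eqxx big1 // => v /andP [_ /negPf ->].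
  by rewrite big1 // => v vC; case: eqP => // E'; rewrite E' aC in vC.
by rewrite !S -(cC _ pG); case: (p.1 \in C).
Qed.

(* The only parity argument of the proof. *)
Lemma no_single_odd G C x : loopless G -> closed_in G C -> x \in C -> deg G x = 1 ->
  (forall v, v \in C -> v != x -> deg G v = 2) -> False.
Proof.
move=> lG cC xC dx dv; have := sum_deg_closed lG cC.
rewrite (bigD1 x) //= dx (eq_bigr (fun=> 2)) => [|v /andP [vC vx]]; last exact: dv.
by rewrite sum_nat_const; lia.
Qed.

(** [D] contains both ends of every changed edge. A cycle component that avoids [D] was there
    before, so after a move only the components at the changed edges need attention. *)
Lemma bad_away G G' D v :
  (forall p, (p \in G) != (p \in G') -> (p.1 \in D) && (p.2 \in D)) ->
  [disjoint gcomp G' v & D] -> bad G' v -> bad G v /\ gcomp G v = gcomp G' v.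
Proof.
move=> agr dis bv; set C := gcomp G' v.
have eqG p : (p.1 \notin D) || (p.2 \notin D) -> (p \in G) = (p \in G').
  move=> H; apply/eqP; apply/negPn/negP => /agr; move: H.
  by case: (p.1 \in D) => //=; case: (p.2 \in D).
have CD u : u \in C -> u \notin D.
  by move=> uC; rewrite (disjointFr dis uC).
have vC : v \in C by rewrite inE.
have cC : closed_in G C.
  move=> p pG; apply/idP/idP => H.
    by rewrite -(@closed_gcomp G' v p) // -eqG // CD.
  by rewrite (@closed_gcomp G' v p) // -eqG // (CD _ H) orbT.
have sub : gcomp G v \subset C.
  by apply/subsetP => u; rewrite inE; apply: connect_closed cC vC.
have cC' : closed_in G' (gcomp G v).
  move=> p pG'; apply/idP/idP => H.
    by rewrite -(@closed_gcomp G v p) // eqG // CD // (subsetP sub).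
  by rewrite (@closed_gcomp G v p) // eqG // (CD _ (subsetP sub _ H)) orbT.
have E : gcomp G v = C.
  apply/eqP; rewrite eqEsubset sub; apply/subsetP => u; rewrite inE.
  by apply: connect_closed cC' _; rewrite inE.
split=> //; apply/badP => u vu.
have uC : u \in C by rewrite -E inE.
have <- : deg G' u = 2 by apply: (badP _ _ bv); rewrite inE in uC.
apply: eq_card => p; rewrite !inE; case: (boolP (inc p u)) => [iu|]; rewrite ?andbF //.
by rewrite !andbT eqG //; case/orP: iu => /eqP ->; rewrite (CD _ uC) ?orbT.
Qed.

Lemma deg_swap G p q v : p \notin G -> q \in G ->
  deg (swap G p q) v + inc q v = deg G v + inc p v.
Proof.
move=> pG qG; have pq : p != q by apply: contraNneq pG => ->.
have E (A : {set V * V}) r : r \notin A ->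
    deg (r |: A) v = deg A v + inc r v.
  move=> rA; rewrite /deg; case: (boolP (inc r v)) => ir.
    have -> : [set e in r |: A | inc e v] = r |: [set e in A | inc e v].
      by apply/setP => e; rewrite !inE; case: eqP => // ->; rewrite ir.
    by rewrite cardsU1 inE (negPf rA) addnC.
  rewrite addn0; apply: eq_card => e; rewrite !inE.
  by case: eqP => // ->; rewrite (negPf ir) !andbF.
rewrite -(E G p pG) -(E (swap G p q) q); last by rewrite !inE eqxx.
by congr (deg _ v); apply/setP => e; rewrite !inE; case: eqP => [->|] //=; rewrite qG orbT.
Qed.

Lemma deg_del G q v : q \in G -> deg (G :\ q) v + inc q v = deg G v.
Proof.
move=> qG; rewrite /deg; case: (boolP (inc q v)) => iq.
  have -> : [set e in G | inc e v] = q |: [set e in G :\ q | inc e v].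
    by apply/setP => e; rewrite !inE; case: eqP => // ->; rewrite qG iq.
  by rewrite cardsU1 !inE eqxx addnC.
rewrite addn0; apply: eq_card => e; rewrite !inE.
by case: eqP => // ->; rewrite (negPf iq) !andbF.
Qed.

End Graph.

(** * Edge sets of a bipartite graph with degrees 4 and 3 *)

Section Bigraph.
Variables (V : finType) (X Y : {set V}) (E : {set V * V}) (Es : seq (V * V)).
Implicit Types (G h : {set V * V}) (p q : V * V) (u v w x y : V) (C R : {set V}).
Hypothesis (XY : X :|: Y = [set: V]) (disXY : [disjoint X & Y]).
Hypothesis EXY : forall p, p \in E -> (p.1 \in X) && (p.2 \in Y).
Hypothesis (dX : forall x, x \in X -> deg E x = 4).
Hypothesis (dY : forall y, y \in Y -> deg E y = 3).
Hypothesis (EsE : Es =i E).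

Lemma XY_neq x y : x \in X -> y \in Y -> x != y.
Proof. by move=> xX yY; apply: contraTneq yY => <-; rewrite (disjointFr disXY xX). Qed.

Lemma X_or_Y v : v \in X \/ v \in Y.
Proof. by apply/orP; rewrite -in_setU XY. Qed.

Lemma incX p x : p \in E -> x \in X -> inc p x = (p.1 == x).
Proof.
move=> /EXY /andP [_ pY] xX; rewrite /inc orbC.
by rewrite eq_sym (negPf (XY_neq xX pY)).
Qed.

Lemma incY p y : p \in E -> y \in Y -> inc p y = (p.2 == y).
Proof.
by move=> /EXY /andP [pX _] yY; rewrite /inc (negPf (XY_neq pX yY)).
Qed.

Lemma sub_loopless G : G \subset E -> loopless G.
Proof. by move=> GE p /(subsetP GE) /EXY /andP [p1 p2]; apply: XY_neq. Qed.

Lemma sum_degX G R : G \subset E -> R \subset X ->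
  #|[set p in G | p.1 \in R]| = \sum_(x in R) deg G x.
Proof.
move=> /subsetP GE /subsetP RX; rewrite -sum1_card (partition_big (fun p => p.1) (mem R)) /=.
  apply: eq_bigr => x xR; rewrite sum1_card; apply: eq_card => p; rewrite !inE.
  rewrite unfold_in /= inE; case pG: (p \in G) => //=; rewrite incX ?GE ?RX //.
  by case: eqP => [->|]; rewrite ?xR ?andbF.
by move=> p; rewrite inE => /andP [].
Qed.

Lemma sum_degY G R : G \subset E -> R \subset Y ->
  #|[set p in G | p.2 \in R]| = \sum_(y in R) deg G y.
Proof.
move=> /subsetP GE /subsetP RX; rewrite -sum1_card (partition_big (fun p => p.2) (mem R)) /=.
  apply: eq_bigr => x xR; rewrite sum1_card; apply: eq_card => p; rewrite !inE.
  rewrite unfold_in /= inE; case pG: (p \in G) => //=; rewrite incY ?GE ?RX //.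
  by case: eqP => [->|]; rewrite ?xR ?andbF.
by move=> p; rewrite inE => /andP [].
Qed.

Lemma swap_sub G p q : G \subset E -> p \in E -> swap G p q \subset E.
Proof.
move=> GE pE; apply: subset_trans (subsetDl _ _) _.
by rewrite subUset sub1set pE.
Qed.

(** * Moving an omitted edge *)

Definition omits1 G := G \subset E /\ forall y, y \in Y -> deg G y = 2.
Definition psiB G := \sum_v (2 - deg G v) + #|bads G|.
Definition actB G v := (deg G v < 2) || bad G v.
Definition nxtB G : seq (V * {set V * V}) :=
  flatten [seq [seq (q.1, swap G p q) | q <- [seq q <- [seq q <- Es | q \in G] | q.2 == p.2]]
          | p <- [seq p <- Es | (p \notin G) && actB G p.1]].

Lemma mem_nxtB G p q : p \in E -> q \in E -> p \notin G -> q \in G -> q.2 = p.2 ->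
  actB G p.1 -> (q.1, swap G p q) \in nxtB G.
Proof.
move=> pE qE pG qG qp ap; apply/flatten_mapP; exists p.
  by rewrite mem_filter pG ap EsE.
by apply/mapP; exists q => //; rewrite !mem_filter qp eqxx qG EsE.
Qed.

Lemma nxtBP G c : omits1 G -> c \in nxtB G -> exists p q,
  [/\ p \in E, p \notin G, q \in G, q.2 = p.2 & actB G p.1 /\ c = (q.1, swap G p q)].
Proof.
move=> [GE _] /flatten_mapP [p]; rewrite mem_filter EsE => /andP [/andP [pG ap] pE].
move=> /mapP [q]; rewrite !mem_filter EsE => /and3P [/eqP qp qG qE] ->.
by exists p, q.
Qed.

Lemma omits1_swap G p q : omits1 G -> p \in E -> p \notin G -> q \in G -> q.2 = p.2 ->
  omits1 (swap G p q).
Proof.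
move=> [GE dG] pE pG qG qp; split; first exact: swap_sub.
move=> y yY; have := deg_swap y pG qG.
by rewrite (incY (subsetP GE _ qG) yY) (incY pE yY) qp dG //; lia.
Qed.

Lemma omits1_nxt G c : omits1 G -> c \in nxtB G -> omits1 c.2.
Proof. by move=> I /(nxtBP I) [p [q [pE pG qG qp [_ ->]]]]; apply: omits1_swap. Qed.

(* Otherwise both swaps close a cycle through p.1 that avoids the removed edge,
   and without p.2 the intersection of the two cycles is a closed set in which
   only p.1 has odd degree. *)
Lemma swap_option G p q1 q2 : omits1 G -> p \in E -> p \notin G ->
  q1 \in G -> q2 \in G -> q1 != q2 -> q1.2 = p.2 -> q2.2 = p.2 ->
  exists2 q, q \in [:: q1; q2] &
    connect (adj (swap G p q)) q.1 p.1 \/ ~~ bad (swap G p q) p.1.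
Proof.
move=> [GE dG] pE pG q1G q2G q12 q1p q2p.
have /andP [xX yY] := EXY pE.
case: (boolP (connect (adj (swap G p q1)) q1.1 p.1)) => c1.
  by exists q1; rewrite ?mem_head //; left.
case: (boolP (bad (swap G p q1) p.1)) => b1; last first.
  by exists q1; rewrite ?mem_head //; right.
case: (boolP (connect (adj (swap G p q2)) q2.1 p.1)) => c2.
  by exists q2; rewrite ?inE ?eqxx ?orbT //; left.
case: (boolP (bad (swap G p q2) p.1)) => b2; last first.
  by exists q2; rewrite ?inE ?eqxx ?orbT //; right.
exfalso; set h := G :\ q1 :\ q2.
have hE : h \subset E by apply: subset_trans GE; rewrite /h !subDset !subsetU ?subxx ?orbT.
have at_y e : e \in G -> e.2 = p.2 -> (e == q1) || (e == q2).
  move=> eG ep; apply: contraT; rewrite negb_or => /andP [e1 e2].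
  have : [set e; q1; q2] \subset [set r in G | inc r p.2].
    apply/subsetP => r; rewrite !inE => /orP [/orP []|] /eqP ->;
      by rewrite ?eG ?q1G ?q2G /inc ?ep ?q1p ?q2p eqxx orbT.
  move/subset_leq_card; rewrite -/(deg G p.2) dG // -setUA cardsU1 cards2 q12.
  by rewrite !inE negb_or e1 e2.
pose I := (gcomp (swap G p q1) p.1 :&: gcomp (swap G p q2) p.1) :\ p.2.
have xI : p.1 \in I by rewrite !inE !connect0 (XY_neq xX yY).
have nq1 v : v \in I -> q1.1 != v.
  rewrite !inE => /and3P [_ vc _]; apply: contraNneq c1 => ->.
  by rewrite conn_sym.
have nq2 v : v \in I -> q2.1 != v.
  rewrite !inE => /and3P [_ _ vc]; apply: contraNneq c2 => ->.
  by rewrite conn_sym.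
(* On both cycles [v] has degree 2. Neither removed edge meets [I], so passing to [h] loses only the
   edge [p], at [p.1]. *)
have dh v : v \in I -> deg h v + (p.1 == v) = 2.
  move=> vI; have := vI; rewrite !inE => /and3P [vy v1 v2].
  have i1 : inc q1 v = false by rewrite /inc (negPf (nq1 v vI)) q1p eq_sym (negPf vy).
  have i2 : inc q2 v = false by rewrite /inc (negPf (nq2 v vI)) q2p eq_sym (negPf vy).
  have q2h : q2 \in G :\ q1 by rewrite !inE q2G eq_sym q12.
  have := deg_swap v pG q1G; rewrite i1 (badP _ _ b1 _ v1).
  have := deg_del v q1G; have := deg_del v q2h; rewrite -/h i1 i2.
  have -> : inc p v = (p.1 == v) by rewrite /inc [p.2 == v]eq_sym (negPf vy) orbF.
  by clear; lia.
apply: (@no_single_odd _ h I p.1) => //.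
- exact: sub_loopless.
- move=> e; rewrite !inE => /and3P [e2 e1 eG].
  have ey2 : e.2 != p.2.
    by apply/negP => /eqP /(at_y _ eG); rewrite (negPf e1) (negPf e2).
  have ey1 : e.1 != p.2.
    by have /andP [eX _] := EXY (subsetP GE _ eG); apply: XY_neq.
  rewrite ey1 ey2 /=.
  have := @closed_gcomp _ (swap G p q1) p.1 e; rewrite !inE => -> //; last by rewrite e1 eG orbT.
  by have := @closed_gcomp _ (swap G p q2) p.1 e; rewrite !inE => -> //; rewrite e2 eG orbT.
- by have := dh _ xI; rewrite eqxx; clear; lia.
- by move=> v vI vx; have := dh _ vI; rewrite eq_sym (negPf vx) addn0.
Qed.

Lemma two_edges G y : omits1 G -> y \in Y ->
  exists q1 q2, [/\ q1 \in G, q2 \in G, q1 != q2, q1.2 = y & q2.2 = y].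
Proof.
move=> [GE dG] yY; have := dG _ yY => /eqP /cards2P [q1 [q2 [q12 EQ]]].
have H q : q \in [set q1; q2] -> q \in G /\ q.2 = y.
  by rewrite -EQ inE => /andP [qG]; rewrite incY ?(subsetP GE) // => /eqP.
have [a b] := H q1 (set21 _ _); have [c d] := H q2 (set22 _ _).
by exists q1, q2.
Qed.

(** Activity of [p.1] means that the move gains at least 1 there: a missing degree is filled or a
    cycle is broken. The loss can only be at [q.1]: its degree falls below 2 or it is left on a
    cycle. These exclude each other, since a cycle needs degree 2 afterwards, and either makes [q.1]
    active. *)
Lemma move_ok G p : omits1 G -> p \in E -> p \notin G -> actB G p.1 ->
  exists q, [/\ q \in G, q.2 = p.2 &
    psiB (swap G p q) < psiB G \/
    psiB (swap G p q) <= psiB G /\ actB (swap G p q) q.1].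
Proof.
move=> IG pE pG ap; have /andP [xX yY] := EXY pE; have [GE dG] := IG.
have [q1 [q2 [q1G q2G q12 q1p q2p]]] := two_edges IG yY.
have [q qin opt] := swap_option IG pE pG q1G q2G q12 q1p q2p.
have [qG qp] : q \in G /\ q.2 = p.2.
  by move: qin; rewrite !inE => /orP [] /eqP ->.
exists q; split=> //; set G' := swap G p q.
have qE := subsetP GE _ qG; have /andP [aX _] := EXY qE.
have pq : p != q by apply: contraNneq pG => ->.
have xa : p.1 != q.1.
  apply: contraNneq pq => xq; apply/eqP; rewrite [p]surjective_pairing xq -qp.
  by rewrite -surjective_pairing.
have pG' : p \in G' by rewrite !inE pq eqxx.
have xy : connect (adj G') p.1 p.2.
  by apply: connect1; rewrite /adj -surjective_pairing pG'.
(* By the choice of [q], a new cycle component through [p.1] would also contain [q.1]; one that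
   avoids [q.1] is an old one. *)
have subB : bads G' \subset
    (if bad G' q.1 then [set gcomp G' q.1] else set0) :|: (bads G :\ gcomp G p.1).
  apply/subsetP => C /imsetP [v]; rewrite inE => bv ->{C}.
  case: (boolP (connect (adj G') v q.1)) => va.
    by rewrite -(bad_connect va) bv !inE gcomp_eq va.
  have vx : ~~ connect (adj G') v p.1.
    case: opt => [ax|nb]; last by apply: contra nb => /bad_connect <-.
    by apply: contra va => vx; apply: connect_trans vx _; rewrite conn_sym.
  have vy : ~~ connect (adj G') v p.2.
    by apply: contra vx => vy; apply: connect_trans vy _; rewrite conn_sym.
  have [] := @bad_away _ G G' [set p.1; p.2; q.1] v _ _ bv.
  - move=> r; rewrite !inE; have [->|rq] := eqVneq r q.
      by rewrite qp !eqxx !orbT.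
    by have [->|rp] := eqVneq r p; rewrite ?eqxx ?orbT //= eqxx.
  - rewrite disjoint_sym disjoints_subset; apply/subsetP => u; rewrite !inE.
    by case/orP => [/orP []|] /eqP ->.
  - move=> bGv cE; rewrite !inE; apply/orP; right; rewrite -cE gcomp_eq.
    have -> : ~~ connect (adj G) v p.1.
      apply: contra vx => c; have : p.1 \in gcomp G v by rewrite inE.
      by rewrite cE inE.
    by apply/imsetP; exists v; rewrite ?inE.
have cB : #|bads G'| <= bad G' q.1 + #|bads G :\ gcomp G p.1|.
  apply: leq_trans (subset_leq_card subB) _; apply: leq_trans (leq_card_setU _ _).1 _.
  by rewrite leq_add2r; case: ifP => _; rewrite ?cards1 ?cards0.
have cB2 : #|bads G| = bad G p.1 + #|bads G :\ gcomp G p.1|.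
  rewrite (cardsD1 (gcomp G p.1)); congr (_ + _); congr nat_of_bool.
  apply/imsetP/idP => [[v]|b]; last by exists p.1; rewrite ?inE.
  by rewrite inE => bv /eqP; rewrite eq_sym gcomp_eq => /bad_connect <-.
have dsum : \sum_v (2 - deg G' v) + (deg G p.1 < 2) =
            \sum_v (2 - deg G v) + (deg G q.1 <= 2).
  have D v := deg_swap v pG qG.
  rewrite (bigD1 p.1) // (bigD1 q.1) 1?eq_sym //= [in RHS](bigD1 p.1) // (bigD1 q.1) 1?eq_sym //=.
  rewrite -/G' in D; rewrite (eq_bigr (fun v => 2 - deg G v)) => [|v /andP [vx va]].
    have := D p.1; have := D q.1; rewrite !incX // !eqxx [q.1 == _]eq_sym (negPf xa).
    rewrite !addn0 !addn1; clear; move: (\sum_(i | _) _) => s.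
    move: (deg G p.1) (deg G q.1) (deg G' p.1) (deg G' q.1) => a b c d.
    by case: (ltnP a 2); case: (leqP b 2) => /=; lia.
  by have := D v; rewrite /inc qp ![_ == v]eq_sym (negPf vx) (negPf va) /=; clear; lia.
have key : psiB G' + 1 <= psiB G + (deg G q.1 <= 2) + bad G' q.1.
  rewrite /psiB; case/orP: ap cB cB2 dsum => [->|b]; first by clear; lia.
  by rewrite b (bad_deg b); clear; lia.
case: (leqP (deg G q.1) 2) key => da key; last first.
  case: (boolP (bad G' q.1)) key => ba key; [right|left; move: key; clear; lia].
  by rewrite /actB ba orbT; split=> //; move: key; clear; lia.
have da' : deg G' q.1 < 2.
  by have := deg_swap q.1 pG qG; move: da; rewrite -/G' !incX // eqxx (negPf xa); clear; lia.
right; rewrite /actB da'; split=> //.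
by move: key; case: (boolP (bad G' q.1)) => [/bad_deg|_]; move: da'; clear; lia.
Qed.

Lemma deg_diff G h x : (forall y, (x, y) \in E -> ((x, y) \in G) = ((x, y) \in h)) ->
  G \subset E -> h \subset E -> x \in X -> deg G x = deg h x.
Proof.
move=> H GE hE xX; apply: eq_card => -[a b]; rewrite !inE.
case abE: ((a, b) \in E); last first.
  have nE (K : {set V * V}) : K \subset E -> (a, b) \in K = false.
    by move=> KE; apply: contraFF abE => /(subsetP KE).
  by rewrite !nE.
rewrite (incX abE xX) /=; case: eqP => [ax|_]; rewrite ?andbF // !andbT.
by rewrite ax in abE *; apply: H.
Qed.

Section StuckB.
Variables (g0 : {set V * V}) (L : seq {set V * V}).
Hypotheses (I0 : omits1 g0) (cL : chain nxtB psiB actB g0 L).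
Let cov := covered actB L.

(** A move changes two edges: the end in X of the added one was active before, that of the removed
    one is active afterwards. So all states agree at an uncovered vertex of X. *)
Lemma chainB_diff G x y : G \in L -> (x, y) \in E ->
  ((x, y) \in G) != ((x, y) \in g0) -> cov x.
Proof.
rewrite /cov; elim: cL G => [|g a g' {}L0 c0 IH g'L nx _ ag nc] G.
  by rewrite inE => /eqP ->; rewrite eqxx.
rewrite inE /covered /= -/(covered actB L0 x) => /predU1P [->|GL] xyE dif; last first.
  by rewrite (IH G) ?orbT.
have Ig' : omits1 g' := chain_inv omits1_nxt I0 c0 g'L.
have [p [q [pE pG qG qp [ap]]]] := nxtBP Ig' nx.
case=> aE gE; have [pxy|pxy] := eqVneq p (x, y).
  by apply/orP; right; apply/hasP; exists g' => //; rewrite pxy in ap.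
have [qxy|qxy] := eqVneq q (x, y); first by rewrite qxy /= in aE; rewrite -aE ag.
rewrite (IH g') ?orbT //; move: dif; rewrite gE !inE.
by rewrite ![(x, y) == _]eq_sym (negPf pxy) (negPf qxy).
Qed.

End StuckB.

(** At such a [y], both kept edges but at most one omitted edge are at covered vertices. This spare
    kept edge pays for the vertices of [loose3], two for each. *)
Definition inner2 (g0 : {set V * V}) L :=
  [set y in Y | [forall c, ((c, y) \in g0) ==> covered actB L c]].
Definition loose3 (g0 : {set V * V}) L :=
  [set c | covered actB L c && (2 < deg g0 c)].

Lemma loose3_base g0 : loose3 g0 [:: g0] = set0.
Proof.
apply/setP => c; rewrite !inE /covered /= orbF /actB.
by apply/negP => /andP [/orP [|/bad_deg]] H; rewrite ?H //; move: H; clear; lia.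
Qed.

(** A vertex of degree above 2 in [g0] is first covered right after losing one edge. It then still
    has degree at least 2, so it is active by lying on a cycle, and its degree was 3. That cycle
    puts both neighbours of the vertex on it into [inner2], where they could not be while the vertex
    was uncovered. *)
Lemma chainB_count g0 L : omits1 g0 -> chain nxtB psiB actB g0 L ->
  #|inner2 g0 [:: g0]| + 2 * #|loose3 g0 L| <= #|inner2 g0 L| /\
  (forall c, c \in loose3 g0 L -> deg g0 c = 3).
Proof.
move=> I0; elim=> [|g a g' {}L cL [IH1 IH2] g'L nx ps ag nc].
  by rewrite loose3_base cards0 muln0 addn0; split=> // c; rewrite inE.
have Ig' : omits1 g' := chain_inv omits1_nxt I0 cL g'L.
have Ig : omits1 g := omits1_nxt Ig' nx.
have cL' : chain nxtB psiB actB g0 (g :: L) := chain_ext cL g'L nx ps ag nc.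
have [p [q [pE pG qG qp [ap]]]] := nxtBP Ig' nx; case=> aE gE.
have qE := subsetP Ig'.1 _ qG.
have /andP [aX qY] := EXY qE; rewrite -aE in aX.
have same c : c \in X -> ~~ covered actB L c -> deg g' c = deg g0 c.
  move=> cX ncov; apply: deg_diff => //; [|exact: Ig'.1|exact: I0.1].
  move=> y cyE; apply/eqP; apply/negPn/negP => /(chainB_diff I0 cL g'L cyE).
  by rewrite (negPf ncov).
(* At any other uncovered vertex of X the move can only add an edge, so a degree above 2 stays above
   2 and the vertex inactive. *)
have only_a c : c \in loose3 g0 (g :: L) -> c \notin loose3 g0 L -> c = a.
  rewrite !inE /covered /= -/(covered actB L c) => /andP [ac d3].
  rewrite d3 andbT => ncov; rewrite (negPf ncov) orbF in ac.
  have cX : c \in X.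
    by case: (X_or_Y c) => // cY; move: d3; rewrite (I0.2 _ cY).
  apply/eqP; apply: contraTT ac => ca.
  have := deg_swap c pG qG; rewrite -gE (same _ cX ncov).
  have -> : inc q c = false by rewrite incX // -aE eq_sym (negPf ca).
  move=> dg; rewrite /actB negb_or; apply/andP; split.
    by move: d3 dg; clear; lia.
  by apply/negP => /bad_deg; move: d3 dg; clear; lia.
have mono v : covered actB L v -> covered actB (g :: L) v.
  by rewrite /covered /= => ->; rewrite orbT.
have sub2 : inner2 g0 L \subset inner2 g0 (g :: L).
  apply/subsetP => y; rewrite !inE => /andP [-> /forallP H] /=.
  by apply/forallP => c; apply/implyP => cy; apply: mono; apply: (implyP (H c)).
have sub3 : loose3 g0 L \subset loose3 g0 (g :: L).
  by apply/subsetP => c; rewrite !inE => /andP [/mono -> ->].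
case: (boolP (a \in loose3 g0 (g :: L))) => aL3; last first.
  have E3 : loose3 g0 (g :: L) = loose3 g0 L.
    apply/eqP; rewrite eqEsubset sub3 andbT; apply/subsetP => c cl.
    by apply: contraT => /(only_a _ cl) ca; rewrite -ca cl in aL3.
  rewrite E3; split=> //; apply: leq_trans IH1 _; exact: subset_leq_card.
have anL : a \notin loose3 g0 L by rewrite !inE (negPf nc).
have d3 : 2 < deg g0 a by move: aL3; rewrite inE => /andP [].
have dga : deg g a + 1 = deg g0 a.
  have := deg_swap a pG qG; rewrite -gE (same _ aX nc) (incX qE aX) -aE eqxx.
  rewrite incX //; case: eqP => [pa|_]; last by move=> /= ->; rewrite addn0.
  case/negP: pG; suff -> : p = q by [].
  by rewrite [p]surjective_pairing pa aE -qp -surjective_pairing.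
have ba : bad g a.
  by move: ag; rewrite /actB ltnNge => /orP [|//]; move: d3 dga; clear; lia.
have d3' : deg g0 a = 3 by move: dga; rewrite (bad_deg ba) => <-.
have E3 : loose3 g0 (g :: L) = a |: loose3 g0 L.
  apply/setP => c; rewrite in_setU1; apply/idP/idP => [cl|/predU1P [->//|]].
    by case: (boolP (c \in loose3 g0 L)) => [_|/(only_a _ cl) ->]; rewrite ?orbT ?eqxx.
  exact: (subsetP sub3).
split; last first.
  by move=> c; rewrite E3 in_setU1 => /predU1P [->|/IH2].
(* The two neighbours of [a] on its cycle in [g]. *)
pose W := [set r.2 | r in [set r in g | inc r a]].
have gE' := subsetP Ig.1; have g0E := subsetP I0.1.
have WE y : y \in W -> (a, y) \in g.
  move=> /imsetP [r]; rewrite inE => /andP [rg ra] ->.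
  by move: ra; rewrite (incX (gE' _ rg) aX) => /eqP <-; rewrite -surjective_pairing.
have Wg0 y : y \in W -> (a, y) \in g0.
  move=> /WE ayg; have ayE := gE' _ ayg.
  have ayg' : (a, y) \in g'.
    move: ayg; rewrite gE !inE => /andP [_ /predU1P [ayp|//]].
    case/negP: pG; suff -> : p = q by [].
    by rewrite [q]surjective_pairing -aE qp -ayp.
  apply: contraT => nay; case/negP: nc.
  by apply: (chainB_diff I0 cL g'L ayE); rewrite ayg' (negPf nay).
have cardW : #|W| = 2.
  rewrite card_in_imset; first exact: bad_deg ba.
  move=> r1 r2; rewrite !inE => /andP [r1g i1] /andP [r2g i2] E2.
  move: i1 i2; rewrite !incX ?gE' // => /eqP e1 /eqP e2.
  by rewrite [r1]surjective_pairing [r2]surjective_pairing e1 e2 E2.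
have Wsub : W \subset inner2 g0 (g :: L).
  apply/subsetP => y yW; have ayg := WE y yW; rewrite !inE.
  have /andP [_ /= -> /=] := EXY (gE' _ ayg).
  apply/forallP => c; apply/implyP => cy.
  case: (boolP ((c, y) \in g)) => cyg; last first.
    apply: (chainB_diff I0 cL' (mem_head _ _) (g0E _ cy)).
    by rewrite cy (negPf cyg).
  rewrite /covered /= /actB -(@bad_connect _ g a c) ?ba ?orbT //.
  by apply: (@connect_trans _ _ y); apply: connect1; rewrite /adj ?ayg ?cyg ?orbT.
have Wdis : [disjoint W & inner2 g0 L].
  rewrite disjoints_subset; apply/subsetP => y yW; rewrite !inE negb_and; apply/orP; right.
  by apply/negP => /forallP /(_ a); rewrite (Wg0 _ yW) (negPf nc).
have : W :|: inner2 g0 L \subset inner2 g0 (g :: L) by rewrite subUset Wsub.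
move/subset_leq_card; rewrite cardsU disjoint_setI0 // cards0 subn0 cardW E3 cardsU1 anL.
by move: IH1; clear; lia.
Qed.

(* Every omitted edge (x, y) with x covered has a kept edge (a, y) with a
   covered.  Counting the edges at covered vertices therefore shows that an
   unfinished search is never stuck. *)
Lemma stuckB g0 L d : omits1 g0 -> chain nxtB psiB actB g0 L ->
  stuck nxtB psiB actB d L -> psiB g0 = 0.
Proof.
move=> I0 cL st; apply/eqP; apply: contraT; rewrite -lt0n => psi_gt0.
have g0L := chain_mem cL; have ps0 := chain_psi d cL.
pose R := [set x in X | covered actB L x].
have RX : R \subset X by apply/subsetP => x; rewrite inE => /andP [].
have g0E := subsetP I0.1.
have uniq_omit o o' y : y \in Y -> (o, y) \in E -> (o', y) \in E ->
    (o, y) \notin g0 -> (o', y) \notin g0 -> o = o'.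
  move=> yY oE o'E on o'n; apply/eqP; apply: contraT => oo'.
  have : [set p in g0 | inc p y] :|: [set (o, y); (o', y)] \subset [set p in E | inc p y].
    apply/subsetP => p; rewrite !inE => /orP [/andP [/g0E -> ->]//|].
    by case/orP => /eqP ->; rewrite ?oE ?o'E /inc eqxx orbT.
  move/subset_leq_card; rewrite -/(deg E y) dY // cardsU disjoint_setI0; last first.
    rewrite disjoint_sym disjoints_subset; apply/subsetP => p; rewrite !inE.
    by case/orP => /eqP ->; rewrite ?(negPf on) ?(negPf o'n).
  rewrite cards0 subn0 cards2 -/(deg g0 y) I0.2 //.
  by have -> : (o, y) != (o', y) by apply: contra oo' => /eqP [->].
have tprop x y : (x, y) \in E -> (x, y) \notin g0 -> x \in R ->
    exists2 a, (a, y) \in g0 & a \in R.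
  move=> xyE xyn; rewrite inE => /andP [xX /hasP [G GL aGx]].
  have /andP [_ /= yY] := EXY xyE.
  have IG := chain_inv omits1_nxt I0 cL GL.
  have inR a : (a, y) \in E -> covered actB L a -> a \in R.
    by move=> /EXY /andP [aX _] ca; rewrite inE aX.
  (* If xy is kept in [G], another edge oy is omitted there; it is kept in [g0], and the change
     covers o. Otherwise the move of [move_ok] is available in [G], and since the search is stuck,
     the vertex it makes active is already covered. *)
  case: (boolP ((x, y) \in G)) => xyG.
    have [p pE pG] : exists2 p, p \in E & (p.2 == y) && (p \notin G).
      have : ~~ ([set p in E | inc p y] \subset [set p in G | inc p y]).
        by apply/negP => /subset_leq_card; rewrite -/(deg E y) -/(deg G y) dY // IG.2.
      case/subsetPn => p; rewrite !inE => /andP [pE py]; rewrite py andbT => pG.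
      by exists p; rewrite // pG andbT -incY.
    case: p pE pG => o y' oE /= /andP [/eqP y'y oG]; rewrite {y'}y'y in oE oG.
    exists o; last first.
      apply: inR => //; apply: (chainB_diff I0 cL GL oE); rewrite (negPf oG).
      apply: contraNneq oG => /esym /negbT on.
      by rewrite (uniq_omit o x y).
    apply: contraT => on; case/negP: oG.
    by rewrite (uniq_omit o x y).
  have [q [qG qy mv]] := move_ok IG xyE xyG aGx.
  case: q qG qy mv => a y' /= aG y'y mv; rewrite {y'}y'y in aG mv.
  have aE : (a, y) \in E := subsetP IG.1 _ aG.
  have ca : covered actB L a.
    have cm : (a, swap G (x, y) (a, y)) \in moves nxtB L.
      by apply/flatten_mapP; exists G => //; apply: (mem_nxtB (p := (x, y)) (q := (a, y))).
    have [] := st _ cm; rewrite /improving /extending ps0 /=.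
    rewrite (chain_psi_mem cL GL) in mv.
    case: mv => [->//|[le ->]] _.
    by rewrite -leqNgt le /= negbK.
  exists a; last exact: inR.
  apply: contraT => an; case/negP: xyG; by rewrite (uniq_omit x a y).
(* A double count: [AB] groups these edges by their ends in Y, [sumX] by their ends in X. *)
pose A := [set p in g0 | p.1 \in R]; pose B := [set p in E :\: g0 | p.1 \in R].
have cA : #|A| = \sum_(x in R) deg g0 x by apply: sum_degX => //; exact: I0.1.
have dE x : x \in X -> deg (E :\: g0) x = 4 - deg g0 x.
  move=> xX; rewrite -(dX xX) /deg -[X in _ = X - _](cardsID [set p in g0 | inc p x]).
  have -> : [set p in E | inc p x] :&: [set p in g0 | inc p x] = [set p in g0 | inc p x].
    by apply/setIidPr/subsetP => p; rewrite !inE => /andP [/g0E -> ->].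
  rewrite addKn; apply: eq_card => p; rewrite !inE.
  by case: (inc p x); rewrite ?andbF ?andbT.
have cB : #|B| = \sum_(x in R) (4 - deg g0 x).
  rewrite /B sum_degX ?subsetDl //; apply: eq_bigr => x /(subsetP RX); exact: dE.
have part (K : {set V * V}) : K \subset E ->
    #|K| = \sum_(y in Y) #|[set p in K | p.2 == y]|.
  move=> /subsetP KE; rewrite -sum1_card (partition_big (fun p => p.2) (mem Y)) /=.
    by apply: eq_bigr => y _; rewrite sum1_card; apply: eq_card => p; rewrite !inE.
  by move=> p /KE /EXY /andP [].
have AE : A \subset E by apply/subsetP => p; rewrite inE => /andP [/g0E].
have BE : B \subset E by apply/subsetP => p; rewrite !inE => /andP [/andP []].
have atY y : y \in Y ->
    #|[set p in B | p.2 == y]| + (y \in inner2 g0 L) <= #|[set p in A | p.2 == y]|.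
  move=> yY.
  have kB : #|[set p in B | p.2 == y]| <= 1.
    apply/card_le1_eqP => p r; rewrite !inE.
    case/andP=> /andP [/andP [pn pE] _] /eqP py /andP [/andP [/andP [rn rE] _] /eqP ry].
    rewrite [p]surjective_pairing [r]surjective_pairing py ry; congr (_, _).
    by apply: (uniq_omit _ _ y) => //; rewrite -?py -?surjective_pairing // py -ry -surjective_pairing.
  case: (boolP (y \in inner2 g0 L)) => yi.
    suff : 2 <= #|[set p in A | p.2 == y]| by move: kB; clear; lia.
    rewrite -(I0.2 y yY); apply: subset_leq_card; apply/subsetP => p; rewrite !inE.
    case/andP => pG; rewrite (incY (g0E _ pG) yY) => /eqP py; rewrite pG py eqxx andbT /=.
    have /andP [-> _ /=] := EXY (g0E _ pG); move: yi; rewrite inE => /andP [_ /forallP /(_ p.1)].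
    by rewrite -py -surjective_pairing pG.
  rewrite addn0; case: (posnP #|[set p in B | p.2 == y]|) => [-> //|].
  rewrite card_gt0 => /set0Pn [[x y1]]; rewrite !inE /= => /andP [/andP [/andP [xn xE] xR] /eqP y1E].
  rewrite {y1}y1E in xn xE; apply: leq_trans kB _.
  have [|a ag aR] := tprop x y xE xn; first by rewrite inE.
  by rewrite card_gt0; apply/set0Pn; exists (a, y); move: aR; rewrite !inE /= ag eqxx => ->.
have AB : #|B| + #|inner2 g0 L| <= #|A|.
  rewrite (part A AE) (part B BE).
  have := @leq_sum _ (index_enum V) (mem Y) _ _ atY; rewrite big_split /=; apply: leq_trans.
  rewrite leq_add2l -sum1_card big_mkcond [leqRHS]big_mkcond; apply: leq_sum => y _.
  by rewrite [y \in inner2 _ _]inE; case: (y \in Y) => //=; case: ifP.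
have [cnt d3] := chainB_count I0 cL.
(* Equality holds for the degrees 1, 2 and 3; degree 4 is excluded by [d3]. *)
have perX x : x \in R -> deg g0 x + 2 * (deg g0 x < 2) <= 4 - deg g0 x + 2 * (2 < deg g0 x).
  rewrite inE => /andP [xX cx]; have : 2 < deg g0 x -> deg g0 x = 3.
    by move=> d2; apply: d3; rewrite inE cx.
  move: (deg g0 x) => k; case: (ltnP 2 k) => k3 H; first by rewrite (H isT).
  by case: (ltnP k 2) k3 => /=; clear; lia.
have sumX : #|A| + 2 * \sum_(x in R) (deg g0 x < 2) <= #|B| + 2 * #|loose3 g0 L|.
  rewrite cA cB big_distrr /= -big_split /=.
  have := @leq_sum _ (index_enum V) (mem R) _ _ perX; move/leq_trans; apply.
  rewrite big_split /= -big_distrr /= leq_add2l leq_mul2l /= -sum1_card big_mkcond.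
  rewrite [leqRHS]big_mkcond; apply: leq_sum => x _; rewrite !inE.
  by case: (x \in X) => //=; case: (covered _ _ _).
have over0 : \sum_(x in R) (deg g0 x < 2) = 0.
  by move: AB cnt sumX; clear; lia.
have in0 : #|inner2 g0 [:: g0]| = 0.
  by move: AB cnt sumX; clear; lia.
move: psi_gt0; rewrite /psiB => psi_gt0.
(* A cycle component contains a vertex of Y; its neighbours lie on the cycle and are active, so it
   would be in the empty set [inner2 g0 [:: g0]]. *)
case: (posnP #|bads g0|) => [b0|]; last first.
  rewrite card_gt0 => /set0Pn [C /imsetP [v]]; rewrite inE => bv _.
  have : 0 < deg g0 v by rewrite (bad_deg bv).
  rewrite card_gt0 => /set0Pn [p]; rewrite inE => /andP [pG pv].
  have pE := g0E _ pG; have /andP [_ yY] := EXY pE.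
  have bp : bad g0 p.2.
    case/orP: pv => /eqP pv; last by rewrite pv.
    have b1 : bad g0 p.1 by rewrite pv.
    by rewrite -(@bad_connect _ g0 p.1 p.2) // connect1 // /adj -surjective_pairing pG.
  move/eqP: in0; rewrite cards_eq0 => /eqP /setP /(_ p.2); rewrite !inE yY /=.
  move/negbT/negP; case; apply/forallP => c; apply/implyP => cy.
  rewrite /covered /= orbF /actB -(@bad_connect _ _ p.2) ?bp ?orbT //.
  by rewrite conn_sym connect1 // /adj cy.
move: psi_gt0; rewrite b0 addn0 lt0n sum_nat_eq0 negb_forall => /existsP [v].
rewrite negb_imply /= => d2; have dv : deg g0 v < 2 by move: d2; clear; lia.
have vX : v \in X by case: (X_or_Y v) => // /(I0.2); move: dv; clear; lia.
have vR : v \in R.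
  by rewrite inE vX; apply/hasP; exists g0; rewrite // /actB dv.
by move: over0 => /eqP; rewrite sum_nat_eq0 => /forallP /(_ v); rewrite vR dv.
Qed.

(** * Removing superfluous edges *)

(* No vertex is ever active, so the search just removes edges greedily. *)
Definition thin G := [/\ G \subset E, forall x, x \in X -> 2 <= deg G x,
  forall y, y \in Y -> deg G y <= 2 & forall v, ~~ bad G v].
Definition psiC G := #|G|.
Definition actC G : pred V := pred0.
Definition nxtC G : seq (V * {set V * V}) :=
  [seq (q.1, G :\ q) | q <- [seq q <- [seq q <- Es | q \in G]
                                 | (2 < deg G q.1) && (#|bads (G :\ q)| == 0)]].

Lemma bads0P G : reflect (forall v, ~~ bad G v) (#|bads G| == 0).
Proof.
apply: (iffP idP) => [|H].
  rewrite cards_eq0 => /eqP H v; apply/negP => b.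
  by have : gcomp G v \in bads G; [apply/imsetP; exists v; rewrite ?inE|rewrite H inE].
rewrite cards_eq0; apply/eqP/setP => C; rewrite inE; apply/negP => /imsetP [v].
by rewrite inE (negPf (H v)).
Qed.

Lemma thin_nxtC G c : thin G -> c \in nxtC G -> thin c.2.
Proof.
move=> [GE dx dy nb] /mapP [q]; rewrite !mem_filter => /and3P [/andP [d3 /bads0P nb'] qG _] -> /=.
have qE := subsetP GE _ qG.
split=> //; first exact: subset_trans (subsetDl _ _) GE.
  move=> x xX; have := deg_del x qG; have := dx _ xX; rewrite incX //.
  by case: eqP d3 => [->|_] /=; clear; lia.
by move=> y yY; have := deg_del y qG; have := dy _ yY; clear; lia.
Qed.

Lemma chainC g0 L : chain nxtC psiC actC g0 L -> L = [:: g0].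
Proof. by case. Qed.

(** A cycle component that appears must contain an end of [q], and [q.2] is left with degree at most
    1. *)
Lemma bad_del G q v : thin G -> q \in G -> bad (G :\ q) v ->
  connect (adj (G :\ q)) v q.1 /\ ~~ connect (adj (G :\ q)) v q.2.
Proof.
move=> [GE dx dy nb] qG bv; have qE := subsetP GE _ qG.
have /andP [qX qY] := EXY qE.
have vy : ~~ connect (adj (G :\ q)) v q.2.
  apply/negP => /(badP _ _ bv); have := deg_del q.2 qG; have := dy _ qY.
  by rewrite /inc eqxx orbT; clear; lia.
split=> //; apply: contraT => vx; have /negP [] := nb v.
have [] // := @bad_away _ G (G :\ q) [set q.1; q.2] v _ _ bv.
  by move=> p; rewrite !inE; have [->|pq] := eqVneq p q; rewrite ?eqxx ?orbT //= eqxx.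
rewrite disjoint_sym disjoints_subset; apply/subsetP => u; rewrite !inE.
by case/orP => /eqP ->.
Qed.

(** If each removal leaves a cycle component, both contain the common end x. Their intersection is
    closed once both edges are gone, and there x has degree 1 and every other vertex degree 2. *)
Lemma del_option G q1 q2 : thin G -> q1 \in G -> q2 \in G -> q1 != q2 -> q1.1 = q2.1 ->
  (forall v, ~~ bad (G :\ q1) v) \/ (forall v, ~~ bad (G :\ q2) v).
Proof.
move=> tG q1G q2G q12 q1x.
case: (boolP (#|bads (G :\ q1)| == 0)) => [/bads0P|b1]; first by left.
case: (boolP (#|bads (G :\ q2)| == 0)) => [/bads0P|b2]; first by right.
have ex q : #|bads (G :\ q)| != 0 -> q \in G -> bad (G :\ q) q.1 /\
    ~~ connect (adj (G :\ q)) q.1 q.2.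
  rewrite -lt0n card_gt0 => /set0Pn [C /imsetP [v]]; rewrite inE => bv _ qG.
  have [vx vy] := bad_del tG qG bv.
  split; first by rewrite -(bad_connect vx).
  by apply: contra vy => xy; apply: connect_trans vx xy.
have {ex b1 b2}[[B1 N1] [B2 N2]] := (ex _ b1 q1G, ex _ b2 q2G).
have [GE dx dy nb] := tG.
have q2E := subsetP GE _ q2G; have /andP [xX _] := EXY q2E.
rewrite q1x in B1 N1; set x := q2.1 in xX B1 N1 B2 N2.
exfalso; set h := G :\ q1 :\ q2.
have q2h : q2 \in G :\ q1 by rewrite !inE q2G eq_sym q12.
have hE : h \subset E by apply: subset_trans GE; rewrite /h !subDset !subsetU ?subxx ?orbT.
pose I := gcomp (G :\ q1) x :&: gcomp (G :\ q2) x.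
have xI : x \in I by rewrite !inE !connect0.
apply: (@no_single_odd _ h I x) => //; first exact: sub_loopless.
- move=> e; rewrite !inE => /and3P [e2 e1 eG].
  have := @closed_gcomp _ (G :\ q1) x e; rewrite !inE => -> //; last by rewrite e1 eG.
  by have := @closed_gcomp _ (G :\ q2) x e; rewrite !inE => -> //; rewrite e2 eG.
- by have := deg_del x q2h; rewrite -/h (bad_deg B1) /inc eqxx; clear; lia.
move=> v; rewrite !inE => /andP [v1 v2] vx.
have := deg_del v q2h; rewrite -/h (badP _ _ B1 _ v1) /inc eq_sym (negPf vx) /=.
have -> : (q2.2 == v) = false; last by rewrite addn0.
by apply: contraNF N2 => /eqP ->.
Qed.

(** Every removal lowers the potential, so being stuck means having no move, whereas [del_option]
    provides one at any degree above 2. *)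
Lemma stuckC g0 L d : thin g0 -> chain nxtC psiC actC g0 L ->
  stuck nxtC psiC actC d L -> forall x, x \in X -> deg g0 x = 2.
Proof.
move=> tG /chainC -> st x xX; have [GE dx dy nb] := tG.
apply/eqP; apply: contraT => d2; have d3 : 2 < deg g0 x.
  by rewrite ltn_neqAle eq_sym d2 dx.
have /card_gt1P [q1 [q2 [q1x q2x q12]]] : 1 < deg g0 x by apply: ltnW.
have P q : q \in [set p in g0 | inc p x] -> (forall v, ~~ bad (g0 :\ q) v) -> False.
  rewrite inE => /andP [qG]; rewrite incX ?(subsetP GE) // => /eqP qx nb'.
  have [] := st (q.1, g0 :\ q).
    rewrite /moves /= cats0; apply/mapP; exists q => //.
    have b0 : #|bads (g0 :\ q)| == 0 by apply/bads0P.
    by rewrite !mem_filter qx d3 qG EsE (subsetP GE) // b0.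
  by rewrite /improving /psiC /= [in X in _ < X](cardsD1 q) qG ltnSn.
have Q q : q \in [set p in g0 | inc p x] -> q \in g0 /\ q.1 = x.
  by rewrite inE => /andP [qG]; rewrite incX ?(subsetP GE) // => /eqP.
have [[a b] [c e]] := (Q _ q1x, Q _ q2x).
by case: (del_option tG a c q12 (etrans b (esym e))) => [/(P _ q1x)|/(P _ q2x)].
Qed.

(** * Covering the isolated vertices *)

Definition path_like G := [/\ G \subset E, forall x, x \in X -> deg G x = 2,
  forall y, y \in Y -> deg G y <= 2 & forall v, ~~ bad G v].
Definition actD G v := deg G v == 0.
Definition psiD G := #|[set v | actD G v]|.
Definition nxtD G : seq (V * {set V * V}) :=
  flatten [seq [seq (q.2, swap G p q) | q <- [seq q <- [seq q <- Es | q \in G] | q.1 == p.1]]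
          | p <- [seq p <- Es | actD G p.2]].

Lemma actD_notin G p : actD G p.2 -> p \notin G.
Proof.
rewrite /actD cards_eq0 => /eqP H; apply/negP => pG.
by have : p \in set0; [rewrite -H inE pG /inc eqxx orbT|rewrite inE].
Qed.

Lemma nxtDP G c : path_like G -> c \in nxtD G -> exists p q,
  [/\ p \in E, q \in G, q.1 = p.1, actD G p.2 & c = (q.2, swap G p q)].
Proof.
move=> _ /flatten_mapP [p]; rewrite mem_filter EsE => /andP [ap pE].
move=> /mapP [q]; rewrite !mem_filter EsE => /and3P [/eqP qp qG qE] ->.
by exists p, q.
Qed.

(** No cycle component can arise: afterwards [p.2] has degree 1 and [q.2] at most 1, and [p.1] is
    adjacent to [p.2]. *)
Lemma path_like_swap G p q : path_like G -> p \in E -> q \in G -> q.1 = p.1 -> actD G p.2 ->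
  path_like (swap G p q).
Proof.
move=> [GE dx dy nb] pE qG qp ap; have pG := actD_notin ap.
have qE := subsetP GE _ qG; have /andP [xX yY] := EXY pE.
have /andP [_ y1Y] := EXY qE.
have D v := deg_swap v pG qG.
have yy1 : p.2 != q.2.
  by apply: contraNneq pG => e; rewrite [p]surjective_pairing e -qp -surjective_pairing.
split; first exact: swap_sub.
- by move=> x xX'; have := D x; rewrite !incX // qp dx //; clear; lia.
- move=> y yY'; have := D y; rewrite !incY //; have := dy _ yY'.
  have [e|_] := eqVneq p.2 y; last by clear; lia.
  by move: ap; rewrite /actD e => /eqP -> _; case: (_ == _); clear; lia.
move=> v; apply/negP => bv; set G' := swap G p q in D bv *.
have pG' : p \in G'.
  by rewrite !inE eqxx andbT; apply: contraNneq pG => ->.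
have vy : ~~ connect (adj G') v p.2.
  apply/negP => /(badP _ _ bv); have := D p.2; rewrite !incY // eqxx eq_sym (negPf yy1).
  by move/eqP: ap => ->; clear; lia.
have vy1 : ~~ connect (adj G') v q.2.
  apply/negP => /(badP _ _ bv); have := D q.2; rewrite !incY // eqxx (negPf yy1).
  by have := dy _ y1Y; clear; lia.
have vx : ~~ connect (adj G') v p.1.
  apply: contra vy => vx; apply: connect_trans vx _; apply: connect1.
  by rewrite /adj -surjective_pairing pG'.
have /negP [] := nb v.
have [] // := @bad_away _ G G' [set p.1; p.2; q.2] v _ _ bv.
  move=> r; rewrite !inE; have [->|rq] := eqVneq r q.
    by rewrite qp !eqxx !orbT.
  by have [->|rp] := eqVneq r p; rewrite ?eqxx ?orbT //= eqxx.
rewrite disjoint_sym disjoints_subset; apply/subsetP => u; rewrite !inE.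
by case/orP => [/orP []|] /eqP ->.
Qed.

Lemma path_like_nxt G c : path_like G -> c \in nxtD G -> path_like c.2.
Proof. by move=> I /(nxtDP I) [p [q [pE qG qp ap ->]]]; apply: path_like_swap. Qed.

Lemma deg_diffY G h y : (forall x, (x, y) \in E -> ((x, y) \in G) = ((x, y) \in h)) ->
  G \subset E -> h \subset E -> y \in Y -> deg G y = deg h y.
Proof.
move=> H GE hE yY; apply: eq_card => -[a b]; rewrite !inE.
case abE: ((a, b) \in E); last first.
  have nE (K : {set V * V}) : K \subset E -> (a, b) \in K = false.
    by move=> KE; apply: contraFF abE => /(subsetP KE).
  by rewrite !nE.
rewrite (incY abE yY) /=; case: eqP => [bY|_]; rewrite ?andbF // !andbT.
by rewrite bY in abE *; apply: H.
Qed.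

(** The mirror image of [chainB_diff]: here the vertices that become active are the ends in Y. *)
Lemma chainD_diff g0 L : path_like g0 -> chain nxtD psiD actD g0 L ->
  forall G x y, G \in L -> (x, y) \in E -> ((x, y) \in G) != ((x, y) \in g0) ->
  covered actD L y.
Proof.
move=> I0; elim=> [|g a g' {}L cL IH g'L nx _ ag nc] G x y.
  by rewrite inE => /eqP ->; rewrite eqxx.
rewrite inE /covered /= -/(covered actD L y) => /predU1P [->|GL] xyE dif; last first.
  by rewrite (IH G x) ?orbT.
have Ig' : path_like g' := chain_inv path_like_nxt I0 cL g'L.
have [p [q [pE qG qp ap]]] := nxtDP Ig' nx.
case=> aE gE; have [pxy|pxy] := eqVneq p (x, y).
  by apply/orP; right; apply/hasP; exists g' => //; rewrite pxy in ap.
have [qxy|qxy] := eqVneq q (x, y); first by rewrite qxy /= in aE; rewrite -aE ag.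
rewrite (IH g' x) ?orbT //; move: dif; rewrite gE !inE.
by rewrite ![(x, y) == _]eq_sym (negPf pxy) (negPf qxy).
Qed.

Lemma actD_Y G v : path_like G -> actD G v -> v \in Y.
Proof. by move=> [_ dx _ _]; case: (X_or_Y v) => // /dx; rewrite /actD => ->. Qed.

(** Until the move that first isolates [z], its edges are those of [g0], and that move removes a
    single edge. *)
Lemma coveredD_deg g0 L z : path_like g0 -> chain nxtD psiD actD g0 L ->
  covered actD L z -> z \in Y /\ deg g0 z <= 1.
Proof.
move=> I0; elim=> [|g a g' {}L cL IH g'L nx _ ag nc].
  rewrite /covered /= orbF => az; split; first exact: actD_Y az.
  by rewrite (eqP az).
rewrite /covered /= -/(covered actD L z) => /orP [az|]; last exact: IH.
have Ig' : path_like g' := chain_inv path_like_nxt I0 cL g'L.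
have Ig : path_like g := path_like_nxt Ig' nx.
have zY := actD_Y Ig az; split=> //.
case: (boolP (covered actD L z)) => [/IH [] //|nz].
have -> : deg g0 z = deg g' z.
  apply: deg_diffY => //; [|by case: I0|by case: Ig'].
  move=> x xyE; apply/eqP; apply: contraNT nz; rewrite eq_sym.
  exact: (chainD_diff I0 cL g'L xyE).
have [p [q [pE qG qp ap [aE gE]]]] := nxtDP Ig' nx.
have := deg_swap z (actD_notin ap) qG; rewrite -gE (eqP az).
by case: (inc q z); clear; lia.
Qed.

Lemma move_okD G p q : path_like G -> p \in E -> q \in G -> q.1 = p.1 -> actD G p.2 ->
  psiD (swap G p q) < psiD G \/
  psiD (swap G p q) <= psiD G /\ actD (swap G p q) q.2.
Proof.
move=> [GE dx dy nb] pE qG qp ap; have pG := actD_notin ap.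
have qE := subsetP GE _ qG; have /andP [xX yY] := EXY pE.
have D v := deg_swap v pG qG; set G' := swap G p q in D *.
have sub v : actD G' v -> v != q.2 -> v \in [set v | actD G v] :\ p.2.
  move=> av vq; have := D v; rewrite !inE (eqP av).
  case: (X_or_Y v) => vXY; first by rewrite !incX // qp /actD dx //; clear; lia.
  rewrite !incY // [q.2 == v]eq_sym (negPf vq) [p.2 == v]eq_sym /actD.
  by case: eqP => //= _; clear; lia.
have cp : psiD G = #|[set v | actD G v] :\ p.2|.+1.
  by rewrite /psiD (cardsD1 p.2) inE ap.
rewrite cp ltnS; case: (boolP (actD G' q.2)) => aq; [right; split=> //|left]; last first.
  apply/subset_leq_card/subsetP => v; rewrite inE => av; apply: sub => //.
  by apply: contraNneq aq => <-.
apply: (@leq_trans #|q.2 |: ([set v | actD G v] :\ p.2)|); last first.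
  by rewrite cardsU1; case: (_ \notin _).
apply/subset_leq_card/subsetP => v; rewrite inE in_setU1 => av.
by have [//|vq] := eqVneq v q.2; apply: sub.
Qed.

Lemma stuckD g0 L d : path_like g0 -> chain nxtD psiD actD g0 L ->
  stuck nxtD psiD actD d L -> psiD g0 = 0.
Proof.
move=> I0 cL st; apply/eqP; rewrite cards_eq0; apply: contraT => /set0Pn [z0].
rewrite inE => az0; have g0L := chain_mem cL; have ps0 := chain_psi d cL.
have [g0E dx dy nb] := I0.
pose Z := [set z | covered actD L z].
pose N := [set x in X | [exists y in Z, (x, y) \in E]].
have ZY : Z \subset Y by apply/subsetP => z; rewrite inE => /(coveredD_deg I0 cL) [].
have NX : N \subset X by apply/subsetP => x; rewrite inE => /andP [].
have z0Z : z0 \in Z by rewrite inE; apply/hasP; exists g0.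
have nbr p : p \in g0 -> p.1 \in N -> p.2 \in Z.
  case: p => x y1 /= pg0; rewrite !inE => /andP [xX /existsP [y]].
  rewrite inE => /andP [/hasP [G GL aGy] xyE].
  have pE := subsetP g0E _ pg0.
  (* If the edge is gone in [G], the change covered [y1]. If not, it can be exchanged for xy, and
     since the search is stuck, the newly isolated [y1] is already covered. *)
  case: (boolP ((x, y1) \in G)) => pG; last first.
    by apply: (chainD_diff I0 cL GL pE); rewrite pg0 (negPf pG).
  have IG := chain_inv path_like_nxt I0 cL GL.
  have cm : (y1, swap G (x, y) (x, y1)) \in moves nxtD L.
    apply/flatten_mapP; exists G => //; apply/flatten_mapP; exists (x, y).
      by rewrite mem_filter EsE xyE andbT.
    by apply/mapP; exists (x, y1); rewrite // !mem_filter eqxx pG EsE.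
  have [] := st _ cm; rewrite /improving /extending ps0 /=.
  have [] := move_okD IG xyE pG erefl aGy; rewrite (chain_psi_mem cL GL).
    by move=> ->.
  by move=> [le ->] _; rewrite -leqNgt le /= negbK.
have c1 : #|[set p in E | p.2 \in Z]| <= #|[set p in E | p.1 \in N]|.
  apply/subset_leq_card/subsetP => -[x y]; rewrite !inE /= => /andP [xyE yZ].
  have /andP [/= -> _] := EXY xyE; rewrite xyE; apply/existsP; exists y.
  by rewrite inE yZ.
have c2 : #|[set p in g0 | p.1 \in N]| <= #|[set p in g0 | p.2 \in Z]|.
  apply/subset_leq_card/subsetP => p; rewrite 2![_ \in [set _ in _ | _]]inE.
  by move=> /andP [pg /(nbr p pg) ->]; rewrite pg.
move: c1 c2; rewrite !sum_degX // !sum_degY //.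
rewrite (eq_bigr (fun=> 3)) => [|y /(subsetP ZY)]; last exact: dY.
rewrite [X in _ <= X -> _](eq_bigr (fun=> 4)) => [|x /(subsetP NX)]; last exact: dX.
rewrite [X in _ -> X <= _ -> _](eq_bigr (fun=> 2)) => [|x /(subsetP NX)]; last exact: dx.
rewrite !sum_nat_const.
have : \sum_(z in Z) deg g0 z < #|Z|.
  rewrite (bigD1 z0) //= (eqP az0) add0n (cardD1 z0) z0Z add1n ltnS -sum1_card.
  rewrite [leqRHS](eq_bigl (fun z => (z \in Z) && (z != z0))); last by move=> z; rewrite !inE andbC.
  apply: leq_sum => z /andP [zZ _].
  by move: zZ; rewrite inE => /(coveredD_deg I0 cL) [].
by clear; lia.
Qed.

Lemma omits1_thin G : omits1 G -> psiB G = 0 -> thin G.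
Proof.
move=> [GE dG] /eqP; rewrite addn_eq0 sum_nat_eq0 => /andP [/forallP d2 /bads0P nb].
split=> // [x _|y /dG ->] //; by have := d2 x; rewrite subn_eq0.
Qed.

Lemma thin_path_like G : thin G -> (forall x, x \in X -> deg G x = 2) -> path_like G.
Proof. by case. Qed.

End Bigraph.

(** * Path components *)

Section PathFactor.
Variables (n : nat) (f : rel 'I_n).
Implicit Types (u v w x : 'I_n) (q s : seq 'I_n).

Lemma zip_nextP x q a b :
  reflect (exists2 i, i < size q & a = nth x (x :: q) i /\ b = nth x q i)
    ((a, b) \in zip (x :: q) q).
Proof.
have sz : size (zip (x :: q) q) = size q by rewrite size_zip /=; lia.
apply: (iffP (nthP (x, x))) => -[i]; rewrite ?sz => iq.
  by rewrite nth_zip_cond sz iq => -[<- <-]; exists i.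
by move=> [-> ->]; exists i; rewrite ?sz // nth_zip_cond sz iq.
Qed.

Lemma degree_le1 v w : (forall u, f v u -> u = w) -> degree f v <= 1.
Proof.
move=> H; rewrite -(cards1 w); apply/subset_leq_card/subsetP => u.
by rewrite !inE => /H ->.
Qed.

Lemma path_component_ends x q : path_component f x q ->
  degree f x <= 1 /\ degree f (last x q) <= 1.
Proof.
move=> [q0 /[dup] uxq /= /andP [xq uq] memq fE].
have nbr a w : a \in x :: q -> f a w ->
    ((a, w) \in zip (x :: q) q) || ((w, a) \in zip (x :: q) q).
  move=> ain aw; rewrite -fE // memq; apply: connect_trans (connect1 aw).
  by move: ain; rewrite memq.
split.
  apply: (@degree_le1 _ (nth x q 0)) => w /(nbr _ _ (mem_head _ _)).
  case/orP => /zip_nextP [i iq [xi wi]].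
    case: i xi wi iq => // i /= xi _ iq.
    by case/negP: xq; rewrite xi mem_nth // ltnW.
  by case/negP: xq; rewrite wi mem_nth.
apply: (@degree_le1 _ (nth x (x :: q) (size q).-1)) => w /(nbr _ _ (mem_last _ _)).
have E : last x q = nth x (x :: q) (size q) by rewrite -[size q]/(size (x :: q)).-1 nth_last.
case/orP => /zip_nextP [i iq]; rewrite E => -[a b].
  by have /eqP := a; rewrite nth_uniq //= ?ltnS 1?ltnW //; move: iq; lia.
have /eqP := b; rewrite -[nth x q i]/(nth x (x :: q) i.+1) nth_uniq //= => /eqP ->.
by rewrite a.
Qed.

Hypotheses (f_sym : symmetric f) (f_irr : irreflexive f).
Hypothesis f_deg : forall v, degree f v <= 2.

(* A longest path from a vertex of degree 1 leaves no room for further edges. *)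
Lemma path_from_leaf u : degree f u = 1 -> exists q, path_component f u q.
Proof.
move=> du.
pose P k := [exists t : k.-tuple 'I_n, path f u t && uniq (u :: t)].
have exP : exists k, P k by exists 0; apply/existsP; exists [tuple].
have ubP k : P k -> k <= n.
  move=> /existsP [t] /andP [_ /card_uniqP]; rewrite /= size_tuple => Et.
  by have := max_card (mem (u :: t)); rewrite Et card_ord; lia.
case: (ex_maxnP exP ubP) => k /existsP [t /andP [pt ut]] kmax.
have {}kmax w : f (last u t) w -> w \in u :: t.
  move=> lw; apply: contraT => wt; have : P k.+1; last by move/kmax; rewrite ltnn.
  apply/existsP; exists [tuple of rcons t w].
  by rewrite rcons_path pt lw -rcons_cons rcons_uniq wt ut.
move: (tval t) pt ut kmax => {P exP ubP k t} q pq uq lmax.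
have step i : i < size q -> f (nth u (u :: q) i) (nth u q i).
  by move=> iq; apply/pathP.
have q0 : 0 < size q.
  case: q lmax {pq uq step} => // lmax.
  have : 0 < degree f u by rewrite du.
  by rewrite card_gt0 => /set0Pn [w]; rewrite inE => /[dup] /lmax; rewrite inE => /eqP -> /=; rewrite f_irr.
(* The first vertex has degree 1, and an inner one already has its two neighbours on the path, so no
   other edge can start there. *)
have nbr i w : i < size q -> f (nth u (u :: q) i) w ->
    w = nth u q i \/ 0 < i /\ w = nth u (u :: q) i.-1.
  case: i => [|i] iq fw.
    left; have /card_le1_eqP H : #|[set w | f u w]| <= 1 by rewrite -/(degree f u) du.
    by apply: H; rewrite inE //; apply: (step 0).
  have ne : nth u (u :: q) i != nth u (u :: q) i.+2.
    by rewrite (@nth_uniq _ u (u :: q)) //; move: iq; clear; rewrite /=; lia.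
  have E : [set nth u (u :: q) i; nth u (u :: q) i.+2] = [set w | f (nth u (u :: q) i.+1) w].
    apply/eqP; rewrite eqEcard cards2 ne f_deg andbT; apply/subsetP => v.
    rewrite !inE => /orP [] /eqP ->; last exact: step.
    by rewrite f_sym; apply: step; apply: ltnW.
  have : w \in [set nth u (u :: q) i; nth u (u :: q) i.+2] by rewrite E inE.
  by rewrite !inE => /orP [] /eqP ->; [right|left].
have closed a w : a \in u :: q -> f a w -> w \in u :: q.
  move=> /(nthP u) [i]; rewrite /= ltnS leq_eqVlt => /predU1P [->|iq] <- fw.
    by apply: lmax; rewrite (last_nth u).
  by case: (nbr i w iq fw) => [|[i0]] ->; [rewrite inE mem_nth ?orbT|rewrite mem_nth //=; lia].
exists q; split=> //.
  move=> w; apply/idP/idP => [wq|/connectP [s ps ->]].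
    exact: (path_connect pq wq).
  have : u \in u :: q by rewrite mem_head.
  elim: s {1 2 4}u ps => //= v s IH z /andP [zv ps] zin; apply: IH => //.
  exact: closed zv.
have ordered i j : i < j <= size q -> f (nth u (u :: q) i) (nth u (u :: q) j) -> j = i.+1.
  move=> ij; have lt a b : a <= size q -> b <= size q ->
      nth u (u :: q) a = nth u (u :: q) b -> a = b.
    by move=> la lb /eqP; rewrite (@nth_uniq _ u (u :: q)) // => /eqP.
  move=> fij; have [|E|[i0 E]] := nbr i _ _ fij; first by move: ij; clear; lia.
    by apply: (lt j i.+1) E; move: ij; clear; lia.
  have : j = i.-1 by apply: (lt _ _ _ _ E); move: ij; clear; lia.
  by move: ij i0; clear; lia.
move=> a b ain bin; apply/idP/idP => [fab|/orP [] /zip_nextP [i iq [-> ->]]]; last 2 first.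
- exact: step.
- by rewrite f_sym; apply: step.
move: ain bin fab => /(nthP u) [i iq <-] /(nthP u) [j jq <-] fab.
case: (ltngtP i j) => ij.
- have E : j = i.+1 by apply: ordered fab; rewrite ij.
  by rewrite E in jq *; apply/orP; left; apply/zip_nextP; exists i.
- rewrite f_sym in fab; have E : i = j.+1 by apply: ordered fab; rewrite ij.
  by rewrite E in iq *; apply/orP; right; apply/zip_nextP; exists j.
- by rewrite ij f_irr in fab.
Qed.

(** Rules out cycle components and isolated vertices at once. *)
Hypothesis f_leaf : forall v, exists2 u, connect f v u & degree f u = 1.

Lemma path_factorI (e : rel 'I_n) : subrel f e -> path_factor e f.
Proof.
move=> fe; split=> // v; have [u vu /path_from_leaf [q pc]] := f_leaf v.
exists u, q; split=> //; case: pc => _ _ -> _.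
by rewrite inE (sym_connect_sym f_sym).
Qed.

End PathFactor.

(** * Encoded lists *)

Definition encl (A : Type) (enc : A -> tree) (s : seq A) := encode_seq (map enc s).

Lemma tfoldr_encl A (enc : A -> tree) h z s :
  tfoldr h z (encl enc s) = foldr (fun x r => h (enc x) r) z s.
Proof. by elim: s => //= x s ->. Qed.

Lemma tfilter_encl (A : eqType) (enc : A -> tree) p (q : pred A) s :
  {in s, forall x, truth (p (enc x)) = q x} ->
  tfilter p (encl enc s) = encl enc (filter q s).
Proof.
rewrite /tfilter tfoldr_encl; elim: s => //= x s IH H.
rewrite IH => [|y ys]; last by apply: H; rewrite inE ys orbT.
by rewrite /tif H ?mem_head //; case: (q x).
Qed.

Lemma tmap_encl (A B : Type) (enc : A -> tree) (enc' : B -> tree) f (g : A -> B) s :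
  (forall x, f (enc x) = enc' (g x)) -> tmap f (encl enc s) = encl enc' (map g s).
Proof. by move=> H; rewrite /tmap tfoldr_encl; elim: s => //= x s ->; rewrite H. Qed.

Lemma tapp_encl A (enc : A -> tree) s1 s2 :
  tapp (encl enc s1) (encl enc s2) = encl enc (s1 ++ s2).
Proof. by rewrite /tapp tfoldr_encl; elim: s1 => //= x s ->. Qed.

Lemma tflatmap_encl (A B : eqType) (enc : A -> tree) (enc' : B -> tree) f (g : A -> seq B) s :
  {in s, forall x, f (enc x) = encl enc' (g x)} ->
  tflatmap f (encl enc s) = encl enc' (flatten (map g s)).
Proof.
rewrite /tflatmap tfoldr_encl; elim: s => //= x s IH H.
rewrite IH => [|y ys]; last by apply: H; rewrite inE ys orbT.
by rewrite H ?mem_head // tapp_encl.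
Qed.

Lemma tl_encl A (enc : A -> tree) s : tl (encl enc s) = encl enc (behead s).
Proof. by case: s. Qed.

Lemma truth_tlength a : truth a = (0 < tlength a). Proof. by case: a. Qed.

Lemma tlength_tl a : tlength (tl a) = (tlength a).-1. Proof. by case: a. Qed.

Lemma tlength_encl A (enc : A -> tree) s : tlength (encl enc s) = size s.
Proof. by elim: s => //= x s ->. Qed.

Lemma tlength_nat k : tlength (encode_nat k) = k.
Proof. by elim: k => //= k ->. Qed.

Lemma tlength_sub a b : tlength (tsub a b) = tlength a - tlength b.
Proof. by rewrite /tsub; elim: b => [|x _ b IH] /=; rewrite ?subn0 // tlength_tl IH; lia. Qed.

Lemma tlength_app a b : tlength (tapp a b) = tlength a + tlength b.
Proof. by rewrite /tapp; elim: a => //= x _ a ->. Qed.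

Lemma tlength_flatmap A (enc : A -> tree) f s :
  tlength (tflatmap f (encl enc s)) = \sum_(x <- s) tlength (f (enc x)).
Proof.
rewrite /tflatmap tfoldr_encl; elim: s => [|x s IH] /=; first by rewrite big_nil.
by rewrite tlength_app IH big_cons.
Qed.

Lemma truth_lt a b : truth (tlt a b) = (tlength a < tlength b).
Proof. by rewrite truth_tlength tlength_sub subn_gt0. Qed.

Lemma truth_eq a b : truth (teq a b) = (tlength a == tlength b).
Proof. by rewrite truth_not truth_or !truth_tlength !tlength_sub; lia. Qed.

Lemma truth_two a : truth (ttwo a) = (tlength a == 2).
Proof. by rewrite !truth_and truth_not !truth_tlength !tlength_tl; lia. Qed.

Lemma truth_filter (A : eqType) (enc : A -> tree) p (q : pred A) s :
  {in s, forall x, truth (p (enc x)) = q x} ->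
  truth (tfilter p (encl enc s)) = has q s.
Proof. by move=> /tfilter_encl ->; rewrite truth_tlength tlength_encl size_filter has_count. Qed.

(** * Correctness of the tree programs *)

Section Programs.
Variables (n : nat) (Es : seq ('I_n * 'I_n)).
Hypothesis uEs : uniq Es.
Implicit Types (u v w x y : 'I_n) (p q e : 'I_n * 'I_n) (G : {set 'I_n * 'I_n}).

Definition encv v := encode_nat v.
Definition encp p := Node (encv p.1) (encv p.2).
Definition edges_of G := [seq p <- Es | p \in G].
Definition encs G := encl encp (edges_of G).
Definition encm (c : 'I_n * {set 'I_n * 'I_n}) := Node (encv c.1) (encs c.2).
Let env := Node (encl encv (enum 'I_n)) (encl encp Es).
Definition sub_Es G := {subset G <= Es}.

Lemma truth_eqv u v : truth (teq (encv u) (encv v)) = (u == v).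
Proof. by rewrite truth_eq !tlength_nat. Qed.

Lemma truth_peq p q : truth (tpeq (encp p) (encp q)) = (p == q).
Proof. by rewrite truth_and !truth_eqv. Qed.

Lemma mem_edges_of G p : sub_Es G -> (p \in edges_of G) = (p \in G).
Proof. by move=> GE; rewrite mem_filter andb_idr // => /GE. Qed.

Lemma truth_mem G p : sub_Es G -> truth (tmem (encp p) (encs G)) = (p \in G).
Proof.
move=> GE; rewrite (@truth_filter _ _ _ (pred1 p)) => [|q _]; last by rewrite truth_peq eq_sym.
by rewrite has_pred1 mem_edges_of.
Qed.

Lemma size_edges_of G (a : pred ('I_n * 'I_n)) : sub_Es G ->
  size [seq p <- edges_of G | a p] = #|[set p in G | a p]|.
Proof.
move=> GE; rewrite -(card_uniqP _) ?filter_uniq //.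
by apply: eq_card => p; rewrite mem_filter mem_edges_of // inE andbC.
Qed.

Lemma tlength_inc G v : sub_Es G -> tlength (tinc (encs G) (encv v)) = deg G v.
Proof.
move=> GE; rewrite /tinc (@tfilter_encl _ _ _ (fun p : 'I_n * 'I_n => inc p v)) => [|p _].
  by rewrite tlength_encl size_edges_of.
by rewrite truth_or !truth_eqv.
Qed.

Lemma truth_adj G u w : sub_Es G -> truth (tadj (encs G) (encv u) (encv w)) = adj G u w.
Proof.
move=> GE; rewrite (@truth_filter _ _ _ (pred2 (u, w) (w, u))) => [|p _]; last first.
  by rewrite truth_or (truth_peq p (u, w)) (truth_peq p (w, u)).
apply/hasP/orP => [[p pG /pred2P [] E]|[] H].
- by left; rewrite -E -mem_edges_of.
- by right; rewrite -E -mem_edges_of.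
- by exists (u, w); rewrite ?mem_edges_of //= eqxx.
- by exists (w, u); rewrite ?mem_edges_of //= eqxx orbT.
Qed.

(** Stated for [fixset], which iterates from the empty set as many times as there are vertices,
    exactly as [treach] does. *)
Definition reach_step G v (R : {set 'I_n}) :=
  [set u | (u == v) || [exists w in R, adj G u w]].

Lemma reach_stepE G v : fixset (reach_step G v) = [set u | connect (adj G) v u].
Proof.
have mono : {homo reach_step G v : R S / R \subset S}.
  move=> R S /subsetP RS; apply/subsetP => u; rewrite !inE => /orP [->//|/existsP [w /andP [wR uw]]].
  by apply/orP; right; apply/existsP; exists w; rewrite RS.
apply/eqP; rewrite eqEsubset; apply/andP; split.
  rewrite /fixset; elim: #|_| => [|k IH]; first exact: sub0set.
  apply/subsetP => u; rewrite !inE => /orP [/eqP ->|/existsP [w /andP [/(subsetP IH)]]].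
    exact: connect0.
  rewrite inE => vw uw; apply: connect_trans vw _; apply: connect1.
  by rewrite adj_sym.
have fixP u : u \in fixset (reach_step G v) = (u == v) || [exists w in fixset (reach_step G v), adj G u w].
  by rewrite -{1}(fixsetK mono) inE.
apply/subsetP => u; rewrite inE => /connectP [s ps ->].
have : v \in fixset (reach_step G v) by rewrite fixP eqxx.
elim: s {1 2 4}v ps => //= w s IH z /andP [zw ps] zF; apply: IH => //.
by rewrite fixP; apply/orP; right; apply/existsP; exists z; rewrite zF adj_sym.
Qed.

Lemma treachE G v : sub_Es G ->
  treach (encl encv (enum 'I_n)) (encs G) (encv v) =
  encl encv [seq u <- enum 'I_n | connect (adj G) v u].
Proof.
move=> GE; pose F (R : {set 'I_n}) := encl encv [seq u <- enum 'I_n | u \in R].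
have stepE R : treach_step (encl encv (enum 'I_n)) (encs G) (encv v) (F R) =
    F (reach_step G v R).
  apply: tfilter_encl => u _; rewrite truth_or truth_eqv inE; congr (_ || _).
  rewrite (@truth_filter _ _ _ (adj G u)) => [|w _]; last exact: truth_adj.
  apply/hasP/existsP => [[w]|[w /andP [wR uw]]].
    by rewrite mem_filter => /andP [wR _] uw; exists w; rewrite wR.
  by exists w => //; rewrite mem_filter wR mem_enum.
transitivity (F (fixset (reach_step G v))); last first.
  by rewrite /F reach_stepE; congr (encl _ _); apply: eq_filter => u; rewrite inE.
rewrite /treach tfoldr_encl /fixset cardE; set step := treach_step _ _ _ in stepE *.
have -> : size (enum (mem 'I_n)) = size (enum 'I_n) by [].
elim: (enum 'I_n) => [|u s IH] /=; last by rewrite IH stepE.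
by rewrite /F (eq_filter (a2 := pred0)) ?filter_pred0 // => u; rewrite inE.
Qed.

Let V := encl encv (enum 'I_n).

Lemma truth_bad G v : sub_Es G -> truth (tbad V (encs G) (encv v)) = bad G v.
Proof.
move=> GE; rewrite truth_not treachE // (@truth_filter _ _ _ (fun u : 'I_n => deg G u != 2)).
  apply/hasPn/forallP => H u; last by rewrite mem_filter negbK => /andP [cu _]; apply: (implyP (H u)).
  by apply/implyP => cu; have := H u; rewrite mem_filter cu mem_enum negbK; apply.
by move=> u _; rewrite truth_not truth_two tlength_inc.
Qed.

(** The listed vertices are the representatives [rep v] of the cycle components, so [gcomp] is a
    bijection from them onto [bads G]. *)
Lemma tlength_bads G : sub_Es G -> tlength (tbads V (encs G)) = #|bads G|.
Proof.
move=> GE; pose rep v := head v [seq u <- enum 'I_n | connect (adj G) v u].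
have repP v : connect (adj G) v (rep v).
  have : rep v \in [seq u <- enum 'I_n | connect (adj G) v u].
    have : v \in [seq u <- enum 'I_n | connect (adj G) v u] by rewrite mem_filter connect0 mem_enum.
    by rewrite /rep; case: [seq _ <- _ | _] => //= u s _; rewrite mem_head.
  by rewrite mem_filter => /andP [].
have rep_eq u v : connect (adj G) u v -> rep u = rep v.
  move=> uv; rewrite /rep.
  have -> : [seq w <- enum 'I_n | connect (adj G) v w] = [seq w <- enum 'I_n | connect (adj G) u w].
    by apply: eq_filter => w; rewrite (same_connect (@conn_sym _ G) uv).
  have : u \in [seq w <- enum 'I_n | connect (adj G) u w] by rewrite mem_filter connect0 mem_enum.
  by case: [seq _ <- _ | _].
rewrite /tbads (@tfilter_encl _ _ _ (fun v : 'I_n => (rep v == v) && bad G v)) => [|v _]; last first.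
  rewrite truth_and truth_bad // treachE //; congr (_ && _).
  have : v \in [seq u <- enum 'I_n | connect (adj G) v u] by rewrite mem_filter connect0 mem_enum.
  by rewrite /rep; case: [seq _ <- _ | _] => //= u s _; rewrite truth_eqv.
rewrite tlength_encl -(card_uniqP (filter_uniq _ (enum_uniq _))).
rewrite -(card_in_imset (f := gcomp G)) => [|u v]; last first.
  rewrite !mem_filter => /andP [/andP [/eqP ru _] _] /andP [/andP [/eqP rv _] _] /eqP.
  by rewrite gcomp_eq => /rep_eq; rewrite ru rv.
apply: eq_card => C; apply/imsetP/imsetP => -[v].
  by rewrite mem_filter => /andP [/andP [_ bv] _] ->; exists v; rewrite ?inE.
rewrite inE => bv ->; exists (rep v); last by apply/eqP; rewrite gcomp_eq.
by rewrite mem_filter mem_enum -(rep_eq _ _ (repP v)) eqxx -(bad_connect (repP v)) bv.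
Qed.

Lemma encs_filter G a : {in Es, forall p, truth (a (encp p)) = (p \in G)} ->
  tfilter a (encl encp Es) = encs G.
Proof. exact: tfilter_encl. Qed.

Lemma tswapE G p q : sub_Es G ->
  tswap (encl encp Es) (encs G) (encp p) (encp q) = encs (swap G p q).
Proof.
move=> GE; apply: encs_filter => e _.
by rewrite truth_and truth_or truth_not truth_mem // !truth_peq !inE andbC orbC.
Qed.

Lemma tdelE G q : tdel (encs G) (encp q) = encs (G :\ q).
Proof.
rewrite /tdel (@tfilter_encl _ _ _ (predC1 q)) => [|p _]; last by rewrite truth_not truth_peq.
by rewrite -filter_predI; congr (encl _ _); apply: eq_filter => p; rewrite !inE.
Qed.

Lemma tpsiBE G : sub_Es G -> tlength (tpsiB env (encs G)) = psiB G.
Proof.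
move=> GE; rewrite tlength_app tlength_flatmap tlength_bads // big_enum /=.
by congr (_ + _); apply: eq_bigr => v _; rewrite tlength_sub tlength_inc.
Qed.

Lemma truth_actB G v : sub_Es G -> truth (tactB env (encs G) (encv v)) = actB G v.
Proof.
move=> GE; rewrite truth_or truth_not truth_bad // truth_tlength tlength_tl tlength_inc //.
by rewrite /actB; case: (deg G v) => [|[]].
Qed.

Lemma tnxtBE G : sub_Es G -> tnxtB env (encs G) = encl encm (nxtB Es G).
Proof.
move=> GE; rewrite /tnxtB (@tfilter_encl _ _ _ (fun p : 'I_n * 'I_n => (p \notin G) && actB G p.1)).
  apply: tflatmap_encl => p _; rewrite (@tfilter_encl _ _ _ (fun q : 'I_n * 'I_n => q.2 == p.2)).
    by apply: tmap_encl => q; rewrite tswapE.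
  by move=> q _; rewrite truth_eqv.
by move=> p _; rewrite truth_and truth_not truth_mem // truth_actB.
Qed.

Lemma tpsiCE G : sub_Es G -> tlength (tpsiC env (encs G)) = psiC G.
Proof.
move=> GE; rewrite tlength_encl -(filter_predT (edges_of G)) size_edges_of //.
by apply: eq_card => p; rewrite inE andbT.
Qed.

Lemma tnxtCE G : sub_Es G -> tnxtC env (encs G) = encl encm (nxtC Es G).
Proof.
move=> GE; rewrite /tnxtC (@tfilter_encl _ _ _ (fun q : 'I_n * 'I_n => (2 < deg G q.1) && (#|bads (G :\ q)| == 0))).
  by apply: tmap_encl => q; rewrite tdelE.
move=> q _; rewrite truth_and truth_not !truth_tlength !tlength_tl tlength_inc //.
rewrite tdelE tlength_bads; last by move=> p /setD1P [_ /GE].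
by congr (_ && _); [lia|rewrite -eqn0Ngt].
Qed.

Lemma truth_actD G v : sub_Es G -> truth (tactD env (encs G) (encv v)) = actD G v.
Proof. by move=> GE; rewrite truth_not truth_tlength tlength_inc // -eqn0Ngt. Qed.

Lemma tpsiDE G : sub_Es G -> tlength (tpsiD env (encs G)) = psiD G.
Proof.
move=> GE; rewrite /tpsiD (@tfilter_encl _ _ _ (actD G)) => [|v _]; last exact: truth_actD.
rewrite tlength_encl -(card_uniqP (filter_uniq _ (enum_uniq _))).
by apply: eq_card => v; rewrite mem_filter mem_enum inE andbT.
Qed.

Lemma tnxtDE G : sub_Es G -> tnxtD env (encs G) = encl encm (nxtD Es G).
Proof.
move=> GE; rewrite /tnxtD (@tfilter_encl _ _ _ (fun p : 'I_n * 'I_n => actD G p.2)).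
  apply: tflatmap_encl => p _; rewrite (@tfilter_encl _ _ _ (fun q : 'I_n * 'I_n => q.1 == p.1)).
    by apply: tmap_encl => q; rewrite tswapE.
  by move=> q _; rewrite truth_eqv.
by move=> p _; rewrite truth_actD.
Qed.

Section SearchE.
Variables (tnxt tpsi : tree -> tree -> tree) (tact : tree -> tree -> tree -> tree).
Variables (nxt : {set 'I_n * 'I_n} -> seq ('I_n * {set 'I_n * 'I_n})).
Variables (psi : {set 'I_n * 'I_n} -> nat) (act : {set 'I_n * 'I_n} -> pred 'I_n).
Hypothesis nxtE : forall G, sub_Es G -> tnxt env (encs G) = encl encm (nxt G).
Hypothesis psiE : forall G, sub_Es G -> tlength (tpsi env (encs G)) = psi G.
Hypothesis actE : forall G v, sub_Es G -> truth (tact env (encs G) (encv v)) = act G v.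
Hypothesis nxt_sub : forall G c, sub_Es G -> c \in nxt G -> sub_Es c.2.

Lemma tstateE c : sub_Es c.2 -> tstate env (encm c) = encs c.2.
Proof. by move=> GE; apply: encs_filter => p _; rewrite truth_mem. Qed.

Definition good_list (L : seq {set 'I_n * 'I_n}) :=
  0 < size L /\ forall G, G \in L -> sub_Es G.

Lemma tstepE d L : good_list L ->
  tstep tnxt tpsi tact env (encl encs L) = encl encs (step nxt psi act d L) /\
  good_list (step nxt psi act d L).
Proof.
move=> [L0 LE]; have hL : hd (encl encs L) = encs (head d L) by case: L L0 {LE}.
have dE : sub_Es (head d L) by apply: LE; case: L L0 {hL} => //= ? ? _; rewrite mem_head.
have mE : tflatmap (tnxt env) (encl encs L) = encl encm (moves nxt L).
  by apply: tflatmap_encl => G /LE; apply: nxtE.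
have cE c : c \in moves nxt L -> sub_Es c.2.
  by move=> /flatten_mapP [G /LE GE]; apply: nxt_sub.
have iE : tfilter (timproving tpsi env (encl encs L)) (encl encm (moves nxt L)) =
    encl encm [seq c <- moves nxt L | improving psi d L c].
  by apply: tfilter_encl => c /cE cE'; rewrite truth_lt hL !psiE.
have eE : tfilter (textending tpsi tact env (encl encs L)) (encl encm (moves nxt L)) =
    encl encm [seq c <- moves nxt L | extending psi act d L c].
  apply: tfilter_encl => c /cE cE'; rewrite !truth_and !truth_not truth_lt hL !psiE //.
  rewrite actE //; congr (_ && (_ && ~~ _)).
  by apply: truth_filter => G /LE GE; rewrite actE.
rewrite /tstep mE iE eE /step /tstep2 /tif.
case E1: [seq c <- moves nxt L | improving psi d L c] => [|c s] /=; last first.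
  have c2 : sub_Es c.2.
    by apply: cE; have : c \in c :: s by [rewrite mem_head]; rewrite -E1 mem_filter => /andP [].
  by rewrite tstateE //; split=> //; split=> // G; rewrite inE => /eqP ->.
case E2: [seq c <- moves nxt L | extending psi act d L c] => [|c s] //=.
have c2 : sub_Es c.2.
  by apply: cE; have : c \in c :: s by [rewrite mem_head]; rewrite -E2 mem_filter => /andP [].
by rewrite tstateE //; split=> //; split=> // G; rewrite inE => /predU1P [->|/LE].
Qed.

Lemma tsearchE g clock : sub_Es g ->
  tsearch tnxt tpsi tact env (encs g) clock =
  encs (head g (iter (tlength clock) (step nxt psi act g) [:: g])).
Proof.
move=> gE; rewrite /tsearch.
suff [-> [s0 _]] : tfoldr (fun _ L => tstep tnxt tpsi tact env L) (Node (encs g) Leaf) clock =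
    encl encs (iter (tlength clock) (step nxt psi act g) [:: g]) /\
    good_list (iter (tlength clock) (step nxt psi act g) [:: g]).
  by case: (iter _ _ _) s0.
elim: clock => [|x _ c [IH1 IH2]] /=; last by rewrite IH1; apply: tstepE.
by split=> //; split=> // G; rewrite inE => /eqP ->.
Qed.

End SearchE.

End Programs.

(** * Input and output *)

(** The final counter [k] is general for the induction: the tail of a list numbered from [k] is
    numbered from [k.+1]. *)
Lemma tindex_foldr k (s : seq tree) :
  tfoldr tindex_step (Node (encode_nat (k + size s)) Leaf) (encode_seq s) =
  Node (encode_nat k)
    (encl (fun r => Node (encode_nat r.1) r.2) (zip (iota k (size s)) s)).
Proof.
elim: s k => [|x s IH] k /=; first by rewrite addn0.
by rewrite -addSnnS IH /tindex_step.
Qed.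

Lemma tsize_nat k : tsize (encode_nat k) = (2 * k).+1.
Proof. by elim: k => //= k ->; lia. Qed.

Lemma tsize_encl A (enc : A -> tree) (s : seq A) B : (forall x, tsize (enc x) <= B) ->
  tsize (encl enc s) <= size s * B.+1 + 1.
Proof. by move=> H; elim: s => //= x s; have := H x; rewrite -/(encl enc s); clear; nia. Qed.

Section Input.
Variables (n : nat) (e : rel 'I_n).
Implicit Types (i j v x y : 'I_n).

Definition nb i := [seq j <- enum 'I_n | e i j].
Definition encr i := Node (encv i) (encl (@encv n) (nb i)).
Definition cubics := [seq i <- enum 'I_n | degree e i == 3].
Definition edge_list := [seq (x, y) | y <- cubics, x <- nb y].
Definition start_list := [seq (x, y) | y <- cubics, x <- behead (nb y)].

Lemma uniq_nb i : uniq (nb i). Proof. exact: filter_uniq (enum_uniq _). Qed.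

Lemma mem_nb i j : (j \in nb i) = e i j.
Proof. by rewrite mem_filter mem_enum andbT. Qed.

Lemma size_nb i : size (nb i) = degree e i.
Proof.
rewrite -(card_uniqP (uniq_nb i)); apply: eq_card => j.
by rewrite mem_nb inE.
Qed.

Lemma tindexE : tindex (encode_graph e) = encl encr (enum 'I_n).
Proof.
rewrite /tindex /encode_graph; set s := map _ (enum 'I_n).
have szs : size s = size (enum 'I_n) by rewrite size_map.
have -> : tlen (encode_seq s) = encode_nat (0 + size s).
  by rewrite add0n; elim: s {szs} => //= x s; rewrite /tlen /tmap /= => ->.
rewrite tindex_foldr /= szs size_enum_ord -val_enum_ord zip_map.
by rewrite /encl -map_comp.
Qed.

Lemma trowsE : trows (encl encr (enum 'I_n)) = encl encr cubics.
Proof.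
apply: tfilter_encl => i _; rewrite truth_and truth_not !truth_tlength !tlength_tl /=.
by rewrite tlength_encl size_nb; lia.
Qed.

Lemma tedgesE : tedges (encl encr (enum 'I_n)) = encl (@encp n) edge_list.
Proof.
rewrite /tedges trowsE; apply: tflatmap_encl => y _.
exact: tmap_encl.
Qed.

Lemma tstartE : tstart (encl encr (enum 'I_n)) = encl (@encp n) start_list.
Proof.
rewrite /tstart trowsE; apply: tflatmap_encl => y _.
by rewrite /encr /= tl_encl; apply: tmap_encl.
Qed.

Lemma tenvE : tenv (encl encr (enum 'I_n)) =
  Node (encl (@encv n) (enum 'I_n)) (encl (@encp n) edge_list).
Proof.
rewrite /tenv tedgesE; congr Node.
by rewrite (@tmap_encl _ _ _ (@encv n) _ id) // map_id.
Qed.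

Lemma mem_pairs (t : 'I_n -> seq 'I_n) p :
  (p \in [seq (x, y) | y <- cubics, x <- t y]) =
  (degree e p.2 == 3) && (p.1 \in t p.2).
Proof.
case: p => a b; apply/allpairsPdep/andP => [[y [x [yc xt [-> ->]]]]|[/= d3 pt]].
  by split=> //; move: yc; rewrite mem_filter => /andP [].
by exists b, a; rewrite mem_filter d3 mem_enum.
Qed.

Lemma uniq_pairs (t : 'I_n -> seq 'I_n) : (forall y, uniq (t y)) ->
  uniq [seq (x, y) | y <- cubics, x <- t y].
Proof.
move=> ut; apply: allpairs_uniq_dep => //.
  exact: filter_uniq (enum_uniq _).
by move=> [y1 x1] [y2 x2] _ _ /= [-> ->].
Qed.

(** The start list has to be in the order of [edge_list] to be the encoding of a state. *)
Lemma start_subseq : subseq start_list edge_list.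
Proof.
rewrite /start_list /edge_list; elim: cubics => //= y s IH.
apply: cat_subseq IH; apply: map_subseq.
by case: (nb y) => //= x t; apply: subseq_cons.
Qed.

Lemma start_encs : encl (@encp n) start_list = encs edge_list [set p in start_list].
Proof.
rewrite /encs /edges_of {1}(subseq_uniqP (uniq_pairs uniq_nb) start_subseq).
by congr (encl _ _); apply: eq_filter => p; rewrite inE.
Qed.

Lemma toutputE (F : {set 'I_n * 'I_n}) : uniq edge_list -> sub_Es edge_list F ->
  subrel (adj F) e ->
  toutput (encl encr (enum 'I_n)) (encs edge_list F) = encode_graph (adj F).
Proof.
move=> uE FE Fe.
rewrite /toutput (@tmap_encl _ _ _ (fun i => encl (@encv n) [seq j <- enum 'I_n | adj F i j]) _ id).
  by rewrite map_id.
move=> i; rewrite /encr /= (@tfilter_encl _ _ _ (adj F i)) => [|j _]; last exact: truth_adj.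
rewrite -filter_predI; congr (encl _ _); apply: eq_filter => j /=.
by rewrite andb_idr // => /Fe.
Qed.

Lemma tlength_const c l : tlength (tflatmap (fun=> c) l) = tlength l * tlength c.
Proof. by rewrite /tflatmap; elim: l => //= x _ l; rewrite tlength_app mulSn => ->. Qed.

Lemma tlength_clock : tlength (tclock (tenv (encl encr (enum 'I_n)))) =
  (size edge_list + 3 * n + 1) * n.+1.
Proof.
by rewrite tenvE tlength_const !tlength_app /= !tlength_encl size_enum_ord; nia.
Qed.

Lemma tsize_graph : tsize (encode_graph e) <= n.+2 ^ 4.
Proof.
have row i : tsize (encl (@encv n) (nb i)) <= n * (2 * n).+2 + 1.
  apply: leq_trans (@tsize_encl _ _ _ (2 * n).+1 _) _.
    by move=> v; rewrite tsize_nat; have := ltn_ord v; clear; lia.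
  rewrite leq_add2r leq_mul2r size_filter.
  by apply/orP; right; apply: leq_trans (count_size _ _) _; rewrite size_enum_ord.
apply: leq_trans (tsize_encl _ row) _; rewrite size_enum_ord !expnS expn0 muln1.
by clear; nia.
Qed.

End Input.

(** * The three stages on the input graph *)

Section Factor.
Variables (n : nat) (e : rel 'I_n) (Y X : {set 'I_n}).
Hypotheses (e_sym : symmetric e) (e_irr : irreflexive e).
Hypothesis eYX : bipartition e Y X.
Hypothesis eY : forall y, y \in Y -> degree e y = 3.
Hypothesis eX : forall x, x \in X -> degree e x = 4.
Implicit Types (G : {set 'I_n * 'I_n}).

Let E := [set p in edge_list e].
Let Es := edge_list e.
Let uEs : uniq Es := uniq_pairs e (uniq_nb e).
Let EsE : Es =i E. Proof. by move=> p; rewrite inE. Qed.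

Let XY : X :|: Y = [set: 'I_n]. Proof. by case: eYX => <- _ _; rewrite setUC. Qed.
Let disXY : [disjoint X & Y]. Proof. by case: eYX => _; rewrite disjoint_sym. Qed.

Let degY v : (degree e v == 3) = (v \in Y).
Proof.
apply/eqP/idP => [d3|/eY //]; have : v \in X :|: Y by rewrite XY inE.
by rewrite inE => /orP [/eX|//]; rewrite d3.
Qed.

Lemma mem_E p : (p \in E) = (p.2 \in Y) && e p.2 p.1.
Proof. by rewrite -EsE mem_pairs degY mem_nb. Qed.

Let EXY p : p \in E -> (p.1 \in X) && (p.2 \in Y).
Proof.
rewrite mem_E => /andP [pY ep]; case: eYX => _ _ /(_ _ _ ep).
by rewrite pY (disjointFl disXY pY) /= orbF andbT.
Qed.

Lemma adj_E : adj E =2 e.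
Proof.
move=> u v; rewrite /adj !mem_E /= [e v u]e_sym -andb_orl andb_idl // => uv.
by case: eYX => _ _ /(_ _ _ uv) /orP [] /andP [a b]; rewrite ?a ?b ?orbT.
Qed.

(** [degree] counts neighbours and [deg] stored pairs. All pairs point from X to Y, so no edge is
    stored twice, and projecting to the other end is a bijection. *)
Lemma degree_adj G v : G \subset E -> degree (adj G) v = deg G v.
Proof.
move=> /subsetP GE; have vXY : v \in X :|: Y by rewrite XY inE.
rewrite /deg; case/setUP: vXY => vS.
  rewrite -(card_in_imset (f := snd)) => [|[a b] [c d]]; last first.
    rewrite !inE => /andP [/GE abE] + /andP [/GE cdE].
    by rewrite !(incX disXY EXY) //= => /eqP -> /eqP -> ->.
  apply: eq_card => w; rewrite inE; apply/orP/imsetP => [|[[a b]]].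
    case=> H; first by exists (v, w); rewrite // inE H /inc eqxx.
    have /andP [_ /= vY] := EXY (GE _ H).
    by rewrite (disjointFr disXY vS) in vY.
  by rewrite inE => /andP [/[dup] abG /GE abE]; rewrite (incX disXY EXY) //= => /eqP <- ->; left.
rewrite -(card_in_imset (f := fst)) => [|[a b] [c d]]; last first.
  rewrite !inE => /andP [/GE abE] + /andP [/GE cdE].
  by rewrite !(incY disXY EXY) //= => /eqP -> /eqP -> ->.
apply: eq_card => w; rewrite inE; apply/orP/imsetP => [|[[a b]]].
  case=> H; last by exists (w, v); rewrite // inE H /inc eqxx orbT.
  have /andP [/= vX _] := EXY (GE _ H).
  by rewrite (disjointFr disXY vX) in vS.
by rewrite inE => /andP [/[dup] abG /GE abE]; rewrite (incY disXY EXY) //= => /eqP <- ->; right.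
Qed.

Let dX x : x \in X -> deg E x = 4.
Proof.
move=> xX; rewrite -degree_adj // -(eX xX); apply: eq_card => w.
by rewrite !inE adj_E.
Qed.

Let dY y : y \in Y -> deg E y = 3.
Proof.
move=> yY; rewrite -degree_adj // -(eY yY); apply: eq_card => w.
by rewrite !inE adj_E.
Qed.

Let sub_E G : G \subset E -> sub_Es Es G.
Proof. by move=> /subsetP GE p /GE; rewrite EsE. Qed.

Let Z := encl (encr e) (enum 'I_n).
Let env := Node (encl (@encv n) (enum 'I_n)) (encl (@encp n) Es).
Let envE : tenv Z = env. Proof. exact: tenvE. Qed.

Section Stage.
Variables (tnxt tpsi : tree -> tree -> tree) (tact : tree -> tree -> tree -> tree).
Variables (nxt : {set 'I_n * 'I_n} -> seq ('I_n * {set 'I_n * 'I_n})).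
Variables (psi : {set 'I_n * 'I_n} -> nat) (act : {set 'I_n * 'I_n} -> pred 'I_n).
Variable Inv : {set 'I_n * 'I_n} -> Prop.
Hypothesis nxtE : forall G, sub_Es Es G -> tnxt env (encs Es G) = encl (encm Es) (nxt G).
Hypothesis psiE : forall G, sub_Es Es G -> tlength (tpsi env (encs Es G)) = psi G.
Hypothesis actE : forall G v, sub_Es Es G -> truth (tact env (encs Es G) (encv v)) = act G v.
Hypothesis nxt_sub : forall G c, sub_Es Es G -> c \in nxt G -> sub_Es Es c.2.
Hypothesis Inv_nxt : forall G c, Inv G -> c \in nxt G -> Inv c.2.
Hypothesis psi_le : forall G, sub_Es Es G -> psi G <= size Es + 3 * n.

(** The program returns the newest state, while the results on stuck searches concern the oldest
    one, [g1]; the equality of their potentials carries the conclusion over. *)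
Lemma search_spec g : sub_Es Es g -> Inv g ->
  exists g1 L,
    [/\ tsearch tnxt tpsi tact env (encs Es g) (tclock env) = encs Es (head g L),
        chain nxt psi act g1 L, stuck nxt psi act g L,
        Inv g1 & Inv (head g L) /\ psi (head g L) = psi g1].
Proof.
move=> gE Ig; pose N := tlength (tclock env).
have le : psi g * #|'I_n|.+1 + #|'I_n| <= N.
  rewrite /N -envE tlength_clock card_ord.
  by have := psi_le gE; rewrite -/Es; clear; nia.
have [g1 I1 [c1 s1]] := search_stuck act Inv_nxt Ig le.
exists g1, (iter N (step nxt psi act g) [:: g]); split=> //.
  exact: (tsearchE nxtE psiE actE nxt_sub).
split; last exact: chain_psi c1.
by apply: (chain_inv Inv_nxt I1 c1); case: c1 => *; rewrite mem_head.
Qed.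

End Stage.

Let swap_subEs G p q : sub_Es Es G -> p \in Es -> sub_Es Es (swap G p q).
Proof.
move=> GE pE r; rewrite !inE => /andP [_ /predU1P [->//|/GE]].
exact.
Qed.

Lemma psiB_le G : psiB G <= 3 * n.
Proof.
rewrite /psiB mulSn addnC leq_add //.
  apply: leq_trans (leq_imset_card _ _) _; rewrite -[n in _ <= n]card_ord.
  exact: max_card.
rewrite -[n in 2 * n]card_ord mulnC -sum_nat_const.
by apply: leq_sum => v _; apply: leq_subr.
Qed.

Lemma omits1_start : omits1 Y E [set p in start_list e].
Proof.
have sub : [set p in start_list e] \subset E.
  by apply/subsetP => p; rewrite !inE; apply: (mem_subseq (start_subseq e)).
split=> // y yY; rewrite -degree_adj //.
have : size (behead (nb e y)) = 2 by rewrite size_behead size_nb eY.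
have ub : uniq (behead (nb e y)).
  by have := uniq_nb e y; case: (nb e y) => //= a s /andP [].
rewrite -(card_uniqP ub) => <-; apply: eq_card => w; rewrite inE /adj !inE !mem_pairs /= !degY yY.
rewrite orb_idl // => /andP [wY yw].
have : (y, w) \in E.
  by rewrite mem_E /= wY -mem_nb; exact: mem_behead yw.
by move/EXY => /= /andP [yX _]; rewrite (disjointFr disXY yX) in yY.
Qed.

Lemma tfactorE : exists F, [/\ tfactor Z = encs Es F, path_like X Y E F & psiD F = 0].
Proof.
have oB : omits1 Y E [set p in start_list e] := omits1_start.
have [||||||| g1 [L [EB cB sB IB1 [IB pB]]]] :=
  @search_spec tnxtB tpsiB tactB (nxtB Es) (@psiB _) (@actB _) (omits1 Y E) _ _ _ _ _ _ _ _ oB.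
- by move=> G GE; apply: tnxtBE.
- by move=> G GE; apply: tpsiBE.
- by move=> G v GE; apply: truth_actB.
- move=> G c GE /flatten_mapP [p]; rewrite mem_filter => /andP [_ pE] /mapP [q _ ->].
  exact: swap_subEs.
- exact: (omits1_nxt disXY EXY EsE).
- by move=> G _; apply: leq_trans (psiB_le G) (leq_addl _ _).
- exact: sub_E oB.1.
set gB := head _ L in EB IB pB.
have psi0 : psiB gB = 0 by rewrite pB; apply: (stuckB XY disXY EXY dX dY EsE IB1 cB sB).
have tC : thin X Y E gB := omits1_thin X IB psi0.
have [||||||| g2 [L2 [EC cC sC IC1 [IC pC]]]] :=
  @search_spec tnxtC tpsiC tactC (nxtC Es) (@psiC _) (@actC _) (thin X Y E) _ _ _ _ _ _ _ _ tC.
- by move=> G GE; apply: tnxtCE.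
- by move=> G GE; apply: tpsiCE.
- by [].
- by move=> G c GE /mapP [q _ ->] p /setD1P [_ /GE].
- exact: (thin_nxtC disXY EXY).
- move=> G GE; apply: leq_trans (leq_addr _ _); rewrite -(card_uniqP uEs).
  by apply/subset_leq_card/subsetP.
- by case: tC => GE _ _ _; exact: sub_E GE.
have dXC := stuckC disXY EXY EsE IC1 cC sC.
(* In stage C the list has a single state, so the returned state is the one that [dXC] speaks of. *)
have {}IC : path_like X Y E (head gB L2).
  by move: IC; rewrite (chainC cC) /= => tG; apply: thin_path_like.
have [||||||| g3 [L3 [ED cD sD ID1 [ID pD]]]] :=
  @search_spec tnxtD tpsiD tactD (nxtD Es) (@psiD _) (@actD _) (path_like X Y E) _ _ _ _ _ _ _ _ IC.
- by move=> G GE; apply: tnxtDE.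
- by move=> G GE; apply: tpsiDE.
- by move=> G v GE; apply: truth_actD.
- move=> G c GE /flatten_mapP [p]; rewrite mem_filter => /andP [_ pE] /mapP [q _ ->].
  exact: swap_subEs.
- exact: (path_like_nxt disXY EXY EsE).
- move=> G _; apply: leq_trans (max_card _) _; rewrite card_ord; clear; lia.
- by case: IC => GE _ _ _; exact: sub_E GE.
exists (head (head gB L2) L3); split=> //.
  by rewrite /tfactor envE /Z tstartE start_encs -/Es EB EC ED.
by rewrite pD; apply: (stuckD XY disXY EXY dX dY EsE ID1 cD sD).
Qed.

Lemma tmainE : exists f : rel 'I_n,
  [/\ tmain (encode_graph e) = encode_graph f, path_factor e f & endpoints_of_degree 3 e f].
Proof.
have [F [FE lF /eqP p0]] := tfactorE; have [FsE dFX dFY nb] := lF.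
have Fe : subrel (adj F) e.
  by move=> u w; rewrite -adj_E /adj => /orP [] /(subsetP FsE) ->; rewrite ?orbT.
have dF v : degree (adj F) v = deg F v := degree_adj v FsE.
have d1 v : 0 < deg F v.
  rewrite lt0n; apply/negP => d0; move: p0; rewrite cards_eq0 => /eqP /setP /(_ v).
  by rewrite !inE /actD d0.
have d2 v : deg F v <= 2.
  have : v \in X :|: Y by rewrite XY inE.
  by rewrite inE => /orP [/dFX ->|/dFY].
have irr : irreflexive (adj F).
  by move=> v; apply: contraFF (e_irr v) => /Fe.
exists (adj F); split.
- rewrite /tmain tindexE -/Z FE; apply: toutputE => //; exact: sub_E.
- apply: path_factorI => // [|v|v]; first exact: adj_sym.
    by rewrite dF.
  have := nb v; rewrite negb_forall => /existsP [u]; rewrite negb_imply => /andP [vu d].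
  by exists u => //; rewrite dF; move: d (d1 u) (d2 u); case: (deg F u) => [|[|[|k]]].
move=> x q /path_component_ends; rewrite !dF.
have P v : deg F v <= 1 -> degree e v = 3.
  move=> dv; apply: eY; have : v \in X :|: Y by rewrite XY inE.
  by rewrite inE => /orP [/dFX|//]; move: dv => /[swap] ->.
by case=> /P -> /P ->.
Qed.

End Factor.

Theorem mainTheorem2 :
  exists (algorithm : cmd) (bound : {poly nat}),
    forall (n : nat) (e : rel 'I_n),
      simple_graph e -> biregular_bigraph34 e ->
      exists (f : rel 'I_n) (t : nat),
        [/\ computes_in_time algorithm (encode_graph e) (encode_graph f) t,
            t <= bound.[(n + num_edges e)%N]%R,
            path_factor e f &
            endpoints_of_degree 3 e f].
Proof.
have [c [k [d [_ run _]]]] := polytime_main.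
(* The inner power bounds the size of the encoded graph by [tsize_graph], the outer one the time on
   a tree of that size. *)
exists c, ((('X + 2%N%:P) ^+ 4 + 2%N%:P) ^+ d)%R.
move=> n e [e_sym e_irr] [Y [X [eYX eY eX]]].
have [f [fE pf ends]] := tmainE e_sym e_irr eYX eY eX.
have [s [t [ex [s0 _] le]]] := run (update (fun=> Leaf) 0 (encode_graph e)).
exists f, t; split=> //; first by exists s; rewrite s0 -fE.
apply: leq_trans le _; rewrite /update eqxx !(horner_exp, hornerD, hornerX, hornerC).
rewrite -[leqRHS]/(((n + num_edges e + 2) ^ 4 + 2) ^ d) !addn2.
case: d {run} => // d; rewrite leq_exp2r // !ltnS.
apply: leq_trans (tsize_graph e) _; rewrite leq_exp2r // !ltnS.
exact: leq_addr.
Qed.
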